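(* Let $\Gamma$ be any Coxeter graph (with finite vertex set $S$), let $G_\Gamma^+$ be the associated Artin monoid and $G_\Gamma$ the associated Artin group. Then the canonical homomorphism $\iota: G_\Gamma^+\to G_\Gamma$ is injective.
   Context: Let $S$ be a finite set. A Coxeter matrix over $S$ is a matrix $M=(m_{s,t})_{s,t\in S}$ with $m_{s,s}=1$ for all $s$, and $m_{s,t}=m_{t,s}\in\{2,3,4,\dots,+\infty\}$ for $s\ne t$. It is encoded by its Coxeter graph $\Gamma$: the vertex set is $S$, two vertices $s,t$ are joined by an edge iff $m_{s,t}\ge 3$, and the edge is labelled by $m_{s,t}$ if $m_{s,t}\ge 4$. For two objects $a,b$ and $m\in\mathbb{N}$, $\mathrm{prod}(a,b;m)$ denotes the alternating word $aba\cdots$ of length $m$ starting with $a$, i.e. $(ab)^{m/2}$ if $m$ is even and $(ab)^{(m-1)/2}a$ if $m$ is odd. Let $\Sigma=\{\sigma_s; s\in S\}$ be a set in bijection with $S$. The Artin group $G_\Gamma$ is the group presented by generators $\Sigma$ and relations $\mathrm{prod}(\sigma_s,\sigma_t;m_{s,t})=\mathrm{prod}(\sigma_t,\sigma_s;m_{s,t})$ for $s,t\in S$, $s\neq t$, $m_{s,t}<+\infty$. The Artin monoid $G_\Gamma^+$ is the monoid (with unit) presented by the same generators and relations. The canonical homomorphism $\iota$ is the monoid homomorphism sending $\sigma_s$ to $\sigma_s$ for all $s\in S$. *)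

(* Defs.v *)
From HB Require Import structures.
From mathcomp Require Import all_boot boolp.

Set Implicit Arguments.
Unset Strict Implicit.
Unset Printing Implicit Defensive.

Local Open Scope group_scope.
Local Open Scope quotient_scope.

Section PresentedMonoid.
Variables (X : choiceType) (R : seq X -> seq X -> Prop).

Inductive word_cong : seq X -> seq X -> Prop :=
| word_cong_rel u v : R u v -> word_cong u v
| word_cong_refl u : word_cong u u
| word_cong_sym u v : word_cong u v -> word_cong v u
| word_cong_trans u v w : word_cong u v -> word_cong v w -> word_cong u w
| word_cong_cat u u' v v' :
    word_cong u u' -> word_cong v v' -> word_cong (u ++ v) (u' ++ v').

Definition word_congb (u v : seq X) : bool := `[< word_cong u v >].

Lemma word_congb_equiv : equiv_class_of word_congb.
Proof.
split=> [u|u v|v u w].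
- exact/asboolP/word_cong_refl.
- by apply/asboolP/asboolP; apply: word_cong_sym.
- move=> /asboolP uv /asboolP vw; apply/asboolP; exact: word_cong_trans uv vw.
Qed.

Canonical word_cong_equiv := EquivRelPack word_congb_equiv.

(* The monoid presented by generators X and relations u = v for R u v. *)
Definition presented_monoid := {eq_quot word_congb}.

HB.instance Definition _ := Choice.on presented_monoid.

Definition pm_word (u : seq X) : presented_monoid := \pi_{eq_quot word_congb} u.

Definition pm_repr (c : presented_monoid) : seq X :=
  @repr _ {eq_quot word_congb} c.

Lemma pm_reprK c : pm_word (pm_repr c) = c.
Proof. exact: (@reprK _ {eq_quot word_congb}). Qed.

Lemma pm_wordP u v : pm_word u = pm_word v <-> word_cong u v.
Proof.
split=> [/(@eqquotP _ _ {eq_quot word_congb})/asboolP //|uv].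
by apply/(@eqquotP _ _ {eq_quot word_congb})/asboolP.
Qed.

Definition pm_mul (c d : presented_monoid) : presented_monoid :=
  pm_word (pm_repr c ++ pm_repr d).

Lemma pm_mulE u v : pm_mul (pm_word u) (pm_word v) = pm_word (u ++ v).
Proof. by apply/pm_wordP/word_cong_cat; apply/pm_wordP/pm_reprK. Qed.

Lemma pm_mulA : associative pm_mul.
Proof.
move=> a b c; rewrite -(pm_reprK a) -(pm_reprK b) -(pm_reprK c).
by rewrite !pm_mulE catA.
Qed.

Lemma pm_mul1 : left_id (pm_word [::]) pm_mul.
Proof. by move=> a; rewrite -(pm_reprK a) pm_mulE. Qed.

Lemma pm_mulr1 : right_id (pm_word [::]) pm_mul.
Proof. by move=> a; rewrite -(pm_reprK a) pm_mulE cats0. Qed.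

HB.instance Definition _ :=
  isMonoid.Build presented_monoid pm_mulA pm_mul1 pm_mulr1.

Definition pm_gen (x : X) : presented_monoid := pm_word [:: x].

Lemma pm_word_nil : pm_word [::] = 1.
Proof. by []. Qed.

Lemma pm_word_cat u v : pm_word (u ++ v) = pm_word u * pm_word v.
Proof. by rewrite -pm_mulE. Qed.

Lemma pm_wordE u : pm_word u = \prod_(x <- u) pm_gen x.
Proof.
elim: u => [|x u IH]; first by rewrite big_nil.
by rewrite big_cons -IH -pm_word_cat.
Qed.

(* Extension of a map on the generators that respects the relations. *)
Definition pm_lift (H : monoidType) (f : X -> H)
    (fR : forall u v, R u v -> \prod_(x <- u) f x = \prod_(x <- v) f x)
    (c : presented_monoid) : H :=
  \prod_(x <- pm_repr c) f x.

Section Lift.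
Variables (H : monoidType) (f : X -> H).
Hypothesis fR : forall u v, R u v -> \prod_(x <- u) f x = \prod_(x <- v) f x.

Lemma pm_lift_word u : pm_lift fR (pm_word u) = \prod_(x <- u) f x.
Proof.
have fC v w : word_cong v w -> \prod_(x <- v) f x = \prod_(x <- w) f x.
  elim=> {v w} [v w /fR //|//|v w _ -> //|v w z _ -> _ -> //|].
  by move=> v v' w w' _ IHv _ IHw; rewrite !big_cat /= IHv IHw.
exact/fC/pm_wordP/pm_reprK.
Qed.

Lemma pm_lift_gen x : pm_lift fR (pm_gen x) = f x.
Proof. by rewrite pm_lift_word big_seq1. Qed.

Lemma pm_lift_morphism : monoid_morphism (pm_lift fR).
Proof.
split; first by rewrite -pm_word_nil pm_lift_word big_nil.
move=> a b; rewrite -(pm_reprK a) -(pm_reprK b) -pm_word_cat.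
by rewrite !pm_lift_word big_cat.
Qed.

HB.instance Definition _ :=
  isUMagmaMorphism.Build presented_monoid H (pm_lift fR) pm_lift_morphism.

Lemma pm_lift_unique (g : presented_monoid -> H) :
  monoid_morphism g -> (forall x, g (pm_gen x) = f x) -> g =1 pm_lift fR.
Proof.
move=> [g1 gM] gf c; rewrite -(pm_reprK c) pm_lift_word.
elim: (pm_repr c) => [|x u IH]; first by rewrite big_nil -g1.
by rewrite big_cons -IH -gf -gM -pm_word_cat.
Qed.

End Lift.
End PresentedMonoid.

Section PresentedGroup.
(* Group words: the letter (x, false) stands for x, and (x, true) for x^-1. *)
Variables (X : choiceType) (R : seq (X * bool) -> seq (X * bool) -> Prop).

Variant group_rel : seq (X * bool) -> seq (X * bool) -> Prop :=
| group_rel_given u v : R u v -> group_rel u v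
| group_rel_cancel x b : group_rel [:: (x, b); (x, ~~ b)] [::].

Definition presented_group := presented_monoid group_rel.

HB.instance Definition _ := Monoid.on presented_group.

Definition inv_word (u : seq (X * bool)) : seq (X * bool) :=
  rev [seq (l.1, ~~ l.2) | l <- u].

Lemma inv_wordK : involutive inv_word.
Proof.
move=> u; rewrite /inv_word map_rev revK -map_comp map_id_in //.
by move=> [x b] _ /=; rewrite negbK.
Qed.

Definition pg_inv (c : presented_group) : presented_group :=
  pm_word group_rel (inv_word (pm_repr c)).

Lemma inv_word_mulr u : word_cong group_rel (u ++ inv_word u) [::].
Proof.
elim: u => [|[x b] u IH]; first exact: word_cong_refl.
rewrite /inv_word map_cons rev_cons -cats1 -/(inv_word u) /= catA.
rewrite -cat1s; apply: (@word_cong_trans _ _ _ ([:: (x, b)] ++ [:: (x, ~~ b)])).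
  apply: word_cong_cat; first exact: word_cong_refl.
  rewrite -[X in word_cong _ _ X]cat0s.
  by apply: word_cong_cat IH _; exact: word_cong_refl.
exact/word_cong_rel/group_rel_cancel.
Qed.

Lemma pg_mulgV : right_inverse 1 pg_inv *%g.
Proof.
move=> c; rewrite -{1}(pm_reprK c) -pm_word_cat.
exact/pm_wordP/inv_word_mulr.
Qed.

Lemma pg_mulVg : left_inverse 1 pg_inv *%g.
Proof.
move=> c; rewrite -{2}(pm_reprK c) -pm_word_cat.
by apply/pm_wordP; rewrite -{2}[pm_repr c]inv_wordK; apply: inv_word_mulr.
Qed.

HB.instance Definition _ := hasInv.Build presented_group pg_inv.
HB.instance Definition _ :=
  Monoid_isGroup.Build presented_group pg_mulVg pg_mulgV.

Definition pg_gen (x : X) : presented_group := pm_gen group_rel (x, false).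

Lemma pg_genV x : (pg_gen x)^-1 = pm_gen group_rel (x, true).
Proof.
apply: (mulgI (pg_gen x)); rewrite mulgV; apply/esym.
rewrite /pg_gen /pm_gen -pm_word_cat.
exact/pm_wordP/word_cong_rel/(group_rel_cancel x false).
Qed.

Definition eval_letter (H : groupType) (f : X -> H) (l : X * bool) : H :=
  if l.2 then (f l.1)^-1 else f l.1.

Lemma presented_group_universal (H : groupType) (f : X -> H) :
  (forall u v, R u v ->
     \prod_(l <- u) eval_letter f l = \prod_(l <- v) eval_letter f l) ->
  exists g : presented_group -> H,
    [/\ monoid_morphism g, forall x, g (pg_gen x) = f x
      & forall h : presented_group -> H, monoid_morphism h ->
          (forall x, h (pg_gen x) = f x) -> h =1 g].
Proof.
move=> fR.
have fG u v : group_rel u v ->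
    \prod_(l <- u) eval_letter f l = \prod_(l <- v) eval_letter f l.
  case=> {u v} [u v /fR //|x b].
  rewrite !big_cons !big_nil mulg1 /eval_letter /=.
  by case: b; rewrite /= ?mulVg ?mulgV.
exists (pm_lift fG); split; first exact: pm_lift_morphism.
  by move=> x; rewrite pm_lift_gen.
move=> h hM hf; apply: pm_lift_unique => // -[x []]; last exact: hf.
rewrite /eval_letter /= -hf -pg_genV.
case: hM => h1 hM; apply: (mulgI (h (pg_gen x))).
by rewrite -hM !mulgV h1.
Qed.

End PresentedGroup.

(* None encodes the entry +oo. *)
Record coxeter_matrix (S : finType) := CoxeterMatrix {
  coxeter_entry :> S -> S -> option nat;
  coxeter_diag : forall s, coxeter_entry s s = Some 1%N;
  coxeter_sym : forall s t, coxeter_entry s t = coxeter_entry t s;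
  coxeter_offdiag : forall s t m,
    s != t -> coxeter_entry s t = Some m -> (2 <= m)%N
}.

(* prod(a, b; m) = a b a ..., with m letters *)
Fixpoint alt_word (X : Type) (a b : X) (m : nat) : seq X :=
  if m is m'.+1 then a :: alt_word b a m' else [::].

Section Artin.
Variables (S : finType) (M : coxeter_matrix S).

Variant artin_rel (X : Type) (gen : S -> X) : seq X -> seq X -> Prop :=
| ArtinRel s t m of s != t & M s t = Some m :
    artin_rel gen (alt_word (gen s) (gen t) m) (alt_word (gen t) (gen s) m).

Definition artin_monoid := presented_monoid (artin_rel id).
HB.instance Definition _ := Monoid.on artin_monoid.

Definition artin_group :=
  presented_group (artin_rel (fun s : S => (s, false))).
HB.instance Definition _ := Group.on artin_group.

Definition artin_monoid_gen (s : S) : artin_monoid := pm_gen (artin_rel id) s.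

Definition artin_group_gen (s : S) : artin_group :=
  pg_gen (artin_rel (fun s : S => (s, false))) s.

Lemma artin_group_gen_rel (u v : seq S) :
  artin_rel id u v ->
  \prod_(s <- u) artin_group_gen s = \prod_(s <- v) artin_group_gen s.
Proof.
have genE w : \prod_(s <- w) artin_group_gen s =
    pm_word (group_rel (artin_rel (fun s : S => (s, false))))
      [seq (s, false) | s <- w].
  by rewrite pm_wordE big_map.
have mapE (a b : S) n : [seq (s, false) | s <- alt_word a b n] =
    alt_word (a, false) (b, false) n.
  by elim: n a b => [//|n IH] a b /=; rewrite IH.
case=> s t m st Mst; rewrite !genE !mapE.
apply/pm_wordP/word_cong_rel/group_rel_given.
exact: (ArtinRel (fun s : S => (s, false)) st Mst).
Qed.

Definition artin_iota : artin_monoid -> artin_group :=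
  pm_lift artin_group_gen_rel.

Lemma artin_iota_morphism : monoid_morphism artin_iota.
Proof. exact: pm_lift_morphism. Qed.

HB.instance Definition _ :=
  isUMagmaMorphism.Build artin_monoid artin_group artin_iota
    artin_iota_morphism.

Lemma artin_iota_gen s : artin_iota (artin_monoid_gen s) = artin_group_gen s.
Proof. exact: pm_lift_gen. Qed.

Lemma artin_iota_unique (g : artin_monoid -> artin_group) :
  monoid_morphism g ->
  (forall s, g (artin_monoid_gen s) = artin_group_gen s) -> g =1 artin_iota.
Proof. exact: pm_lift_unique. Qed.

End Artin.

(* Main.v *)
(* The proof follows Krammer, Paris and Hee.  For a Coxeter graph of small type (labels
   2 and 3 only) without triangles, the Artin monoid acts on the functions on the set
   Phi of positive roots by operators phi s with nonnegative coefficients, which kill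
   the coordinate function of alpha s.  They deform to operators psi x s, differing from
   phi s by x times an operator of rank one and invertible for x <> 0, which still
   satisfy the braid relations.  So the Artin group acts over Q(x), and specializing at x = 0
   shows that two words with the same image in the group act in the same way through
   phi.  A generator s divides a word on the left exactly if the word kills the
   coordinate function of alpha s; hence the words are compared letter by letter.

   A general Coxeter graph is first folded into one of small type: s is sent to the
   product of a column of commuting generators, where the columns of s and t span a
   disjoint union of graphs of type A_(m-1), m being the label of s and t. *)

Require Import Defs.
From HB Require Import structures.
From mathcomp Require Import all_boot all_order all_algebra fraction boolp.
From mathcomp Require Import zify ring.

Set Implicit Arguments.
Unset Strict Implicit.
Unset Printing Implicit Defensive.

Import Order.TTheory GRing.Theory Num.Theory.
Local Open Scope ring_scope.

(** * Small-type root systems *)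

(** The operators [phi s] alone cannot represent the group, since none of them is invertible; the
    operators [psi x s] are invertible but involve signs. Each family has its own task: [psi]
    carries an equality in the group over to the operators, and positivity is available only at x =
    0. There no cancellation occurs, so a word is seen not to kill a coordinate function by
    following a single path of roots. That a left divisor kills is immediate; the converse needs
    such a path. The main obstacle is the term of rank one. Its coefficients are prescribed by a
    recursion on the height of a root, along an arbitrary descent, and independence of the descent
    is a check in rank three. Without triangles, three vertices span only A_3, A_2 x A_1 or A_1^3,
    never the affine graph of type A_2. In the folding, an infinite label has no finite graph of
    type A_(m-1) to offer. But only two words are compared at a time, and a label that is large
    compared to their lengths serves as well; so the folded graph depends on the pair of words. *)

Section SmallType.
Variables (T : finType) (adj : rel T).
Hypothesis adj_sym : symmetric adj.
Hypothesis adj_irr : irreflexive adj.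

Notation vec := {ffun T -> int}.
Implicit Types (s t r x : T) (v w : vec).

(* Boolean hypotheses on vertices slow [lia] down. *)
Ltac zlia := repeat match goal with
  | H : is_true (negb _) |- _ => clear H
  | H : is_true (adj _ _) |- _ => clear H
  end; lia.

Definition alpha s : vec := [ffun i => (i == s)%:Z].
(** The pairing of [alpha s] with [v] for the form with 2 on the diagonal, -1 on edges and 0
    elsewhere. *)
Definition pr s v : int := v s + v s - \sum_(t | adj s t) v t.
Definition refl s v : vec := [ffun i => if i == s then v i - pr s v else v i].

Lemma refl_same s v : refl s v s = v s - pr s v.
Proof. by rewrite ffunE eqxx. Qed.

Lemma refl_other s x v : x != s -> refl s v x = v x.
Proof. by rewrite ffunE => /negbTE ->. Qed.

Lemma adj_neq s t : adj s t -> s != t.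
Proof. by apply: contraTneq => ->; rewrite adj_irr. Qed.

Lemma prD s v w : pr s (v + w) = pr s v + pr s w.
Proof.
rewrite /pr !ffunE (eq_bigr (fun a => v a + w a)); last first.
  by move=> a _; rewrite ffunE.
by rewrite big_split /=; ring.
Qed.

Lemma pr0 s : pr s 0 = 0.
Proof. by rewrite /pr !ffunE big1 // => a _; rewrite ffunE. Qed.

Lemma pr_refl_same s v : pr s (refl s v) = - pr s v.
Proof.
rewrite {1}/pr refl_same (eq_bigr (fun i => v i)); last first.
  by move=> t st; rewrite refl_other // eq_sym adj_neq.
rewrite /pr; set S := \sum_(t | _) _; lia.
Qed.

Lemma pr_refl_adj s t v : adj s t -> pr t (refl s v) = pr t v + pr s v.
Proof.
move=> st; have ts : adj t s by rewrite adj_sym.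
rewrite {1 2}/pr refl_other ?adj_neq //.
rewrite (bigD1 s) //= [in RHS](bigD1 s) //= refl_same.
rewrite (eq_bigr (fun i => v i)); last by move=> i /andP[_ /refl_other].
ring.
Qed.

Lemma pr_refl_perp s t v : t != s -> ~~ adj s t -> pr t (refl s v) = pr t v.
Proof.
move=> ts nst; rewrite /pr refl_other // (eq_bigr (fun i => v i)) // => i ti.
by rewrite refl_other //; apply: contraTneq ti => ->; rewrite adj_sym.
Qed.

Lemma pr_alpha_same s : pr s (alpha s) = 2.
Proof.
rewrite /pr ffunE eqxx big1 // => i si; rewrite ffunE eq_sym.
by rewrite (negbTE (adj_neq si)).
Qed.

Lemma pr_alpha_adj s t : adj s t -> pr s (alpha t) = -1.
Proof.
move=> st; rewrite /pr ffunE (negbTE (adj_neq st)) (bigD1 t) //= ffunE eqxx.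
rewrite big1 ?addr0 // => i /andP[_ it]; by rewrite ffunE (negbTE it).
Qed.

Lemma pr_alpha_perp s t : s != t -> ~~ adj s t -> pr s (alpha t) = 0.
Proof.
move=> st nst; rewrite /pr ffunE (negbTE st) big1 // => i si.
by rewrite ffunE; case: eqP si nst => // -> ->.
Qed.

Lemma pr_alpha_le0 s t : s != t -> pr s (alpha t) <= 0.
Proof.
move=> st; case: (boolP (adj s t)) => a; first by rewrite pr_alpha_adj.
by rewrite pr_alpha_perp.
Qed.

Lemma alpha_inj : injective alpha.
Proof.
by move=> s t /ffunP/(_ s); rewrite !ffunE eqxx; case: eqP.
Qed.

Lemma reflK s v : refl s (refl s v) = v.
Proof.
apply/ffunP => i; rewrite ffunE; case: eqP => [->|/eqP /refl_other -> //].
by rewrite refl_same pr_refl_same; lia.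
Qed.

Lemma refl_fix s v : pr s v = 0 -> refl s v = v.
Proof. by move=> p0; apply/ffunP => i; rewrite ffunE p0 subr0; case: ifP. Qed.

Lemma reflC s t v : ~~ adj s t -> refl s (refl t v) = refl t (refl s v).
Proof.
move=> nst; case: (eqVneq s t) => [-> //|st].
have nts : ~~ adj t s by rewrite adj_sym.
have ts : t != s by rewrite eq_sym.
apply/ffunP => i; rewrite !ffunE !pr_refl_perp //.
by case: (eqVneq i s) => [->|]; [rewrite (negbTE st)|case: eqP].
Qed.

Lemma refl_braid s t v : adj s t ->
  refl s (refl t (refl s v)) = refl t (refl s (refl t v)).
Proof.
move=> st; have ts : adj t s by rewrite adj_sym.
have nst := adj_neq st.
apply/ffunP => i; rewrite !ffunE.
rewrite !(pr_refl_same, pr_refl_adj _ st, pr_refl_adj _ ts).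
case: (eqVneq i s) => [->|_]; first by rewrite (negbTE nst); lia.
by case: eqP; lia.
Qed.

(** Roots are only ever raised here, which makes nonnegativity of the coordinates easy; [Phi_down]
    recovers the downward reflections. *)
Inductive Phi : vec -> Prop :=
| Phi_alpha s : Phi (alpha s)
| Phi_up t v : Phi v -> pr t v < 0 -> Phi (refl t v).

Definition ht v : nat := absz (\sum_i v i).

Lemma sum_refl s v : \sum_i refl s v i = \sum_i v i - pr s v.
Proof.
rewrite (bigD1 s) //= [in RHS](bigD1 s) //= refl_same.
rewrite (eq_bigr (fun i => v i)); last by move=> i /refl_other.
ring.
Qed.

Lemma Phi_ge0 v : Phi v -> forall i, 0 <= v i.
Proof.
elim=> {v} [s i|t v _ IH p i]; first by rewrite ffunE.
by rewrite ffunE; case: eqP => [->|_]; have := IH t; have := IH i; lia.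
Qed.

Lemma htE v : Phi v -> (ht v)%:Z = \sum_i v i.
Proof.
move=> /Phi_ge0 v0; rewrite /ht gez0_abs //; exact: sumr_ge0.
Qed.

(** Induction on the height, comparing [t] with the reflection [r] that produced the root. If they
    are adjacent, the braid relation replaces the path up through [r] and down through [t] by one
    that goes down through [t] and [r], where the induction applies, and then up through [t] and
    [r]. *)
Lemma Phi_down t v : Phi v -> 0 < pr t v -> v <> alpha t -> Phi (refl t v).
Proof.
have [n le_n] := ubnP (ht v).
elim: n => // n IHn in t v le_n *; move=> Phiv.
case: Phiv le_n => {v} [s|r v Phiv prv] le_n ptv nv.
  have [e|st] := eqVneq s t; first by case: nv; rewrite e.
  have ts : t != s by rewrite eq_sym.
  by have := pr_alpha_le0 ts; lia.
have [e|rt] := eqVneq r t; first by rewrite -e reflK.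
have tr : t != r by rewrite eq_sym.
have hv : (ht v < ht (refl r v))%N.
  have := htE Phiv; have := htE (Phi_up Phiv prv); rewrite sum_refl; lia.
have [art|nart] := boolP (adj r t); last first.
  have ntr : ~~ adj t r by rewrite adj_sym.
  move: ptv; rewrite pr_refl_perp // => ptv.
  rewrite reflC //; apply: Phi_up; last by rewrite pr_refl_perp.
  apply: IHn => //; first lia.
  by move=> e; move: prv; rewrite e pr_alpha_perp.
have atr : adj t r by rewrite adj_sym.
have e2 : refl t (refl r v) = refl r (refl t (refl r (refl t v))).
  by rewrite -refl_braid // reflK.
move: (ptv); rewrite pr_refl_adj // => ptv'.
have [eq_vt|/eqP ne_vt] := eqVneq v (alpha t).
  move: prv ptv'; rewrite eq_vt pr_alpha_same pr_alpha_adj // => _ _.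
  suff -> : refl t (refl r (alpha t)) = alpha r by apply: Phi_alpha.
  apply/ffunP => i; rewrite !ffunE pr_refl_adj // pr_alpha_same pr_alpha_adj //.
  by case: (eqVneq i t) => [->|it]; rewrite ?(negbTE tr) //; case: eqP.
have Ptv : Phi (refl t v) by apply: IHn => //; lia.
have httv : (ht (refl t v) < ht v)%N.
  have := htE Phiv; have := htE Ptv; rewrite sum_refl; lia.
have prtv : pr r (refl t v) = pr r v + pr t v by rewrite pr_refl_adj.
have [eq_r|/eqP ne_r] := eqVneq (refl t v) (alpha r).
  move: (f_equal (pr t) eq_r); rewrite pr_refl_same pr_alpha_adj // => pt.
  move: (f_equal (pr r) eq_r); rewrite prtv pr_alpha_same => p2.
  lia.
have Prtv : Phi (refl r (refl t v)) by apply: IHn => //; [lia|rewrite prtv; lia].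
rewrite e2; apply: Phi_up; last first.
  rewrite pr_refl_adj // pr_refl_same prtv pr_refl_adj // pr_refl_same prtv; lia.
apply: Phi_up => //.
by rewrite pr_refl_adj // pr_refl_same prtv; lia.
Qed.

Lemma Phi_refl t v : Phi v -> v <> alpha t -> Phi (refl t v).
Proof.
move=> Pv nv; have [p|p|p] := ltgtP (pr t v) 0.
- exact: Phi_up.
- exact: Phi_down.
- by rewrite refl_fix.
Qed.

(** The form is invariant under reflections, so all roots have norm 2. On two or three vertices the
    norm can be written as a sum of squares, which leaves few candidates. *)
Lemma Phi_norm v : Phi v -> \sum_i v i * pr i v = 2.
Proof.
elim=> {v} [s|s v _ IH _].
  rewrite (bigD1 s) //= pr_alpha_same ffunE eqxx big1 // => i is_.
  by rewrite ffunE (negbTE is_) mul0r.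
suff -> : \sum_i refl s v i * pr i (refl s v) = \sum_i v i * pr i v by [].
have E1 : \sum_(i | adj s i) refl s v i * pr i (refl s v) =
    \sum_(i | adj s i) v i * pr i v + (v s + v s - pr s v) * pr s v.
  have -> : v s + v s - pr s v = \sum_(t | adj s t) v t by rewrite /pr; ring.
  rewrite big_distrl -big_split; apply: eq_bigr => i si /=.
  by rewrite pr_refl_adj // refl_other ?mulrDr // eq_sym adj_neq.
have E2 : \sum_(i | ~~ adj s i && (i != s)) refl s v i * pr i (refl s v) =
    \sum_(i | ~~ adj s i && (i != s)) v i * pr i v.
  by apply: eq_bigr => i /andP[nsi si]; rewrite pr_refl_perp // refl_other.
have split_sum f : \sum_i f i = \sum_(i | adj s i) f i +
    (f s + \sum_(i | ~~ adj s i && (i != s)) f i) :> int.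
  by rewrite (bigID (adj s)) /= (bigD1 (P := fun i => ~~ adj s i) s) ?adj_irr.
rewrite split_sum E1 E2 [in RHS]split_sum refl_same pr_refl_same; ring.
Qed.

Lemma ht_refl s v : Phi v -> Phi (refl s v) ->
  (ht (refl s v))%:Z = (ht v)%:Z - pr s v.
Proof. by move=> Pv Pw; rewrite !htE // sum_refl. Qed.

Lemma sum_supp (J : seq T) (F : T -> int) :
  uniq J -> (forall i, i \notin J -> F i = 0) ->
  \sum_i F i = \sum_(i <- J) F i.
Proof.
move=> uJ F0; rewrite (big_uniq _ uJ) //= (bigID (mem J)) /=.
by rewrite [X in _ + X]big1 ?addr0.
Qed.

Lemma pr_supp (J : seq T) u v :
  uniq J -> (forall i, i \notin J -> v i = 0) ->
  pr u v = v u + v u - \sum_(i <- J | adj u i) v i.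
Proof.
move=> uJ v0; rewrite /pr big_mkcond (@sum_supp J) -?big_mkcond //.
by move=> i /v0 ->; rewrite if_same.
Qed.

Lemma norm_supp (J : seq T) v : Phi v ->
  uniq J -> (forall i, i \notin J -> v i = 0) ->
  \sum_(i <- J) v i * pr i v = 2.
Proof.
move=> Pv uJ v0; rewrite -(Phi_norm Pv) (@sum_supp J) //.
by move=> i /v0 ->; rewrite mul0r.
Qed.

(** * The coefficients of the deformation *)

(* For v in Phi with pr s v <= 0 < pr t v: the value of X s v in terms of lower roots
   that the braid relation between s and t requires.  In the last case the relation
   leaves a choice; this one makes the values for different t agree. *)
Definition mu_rule (X : T -> vec -> int) s t v : int :=
  let w := refl t v in
  if ~~ adj s t then X s w
  else if 0 < pr s w then 2 * X t (refl s w)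
  else if pr s w == 0 then 2 * X t w - X s w
  else X s w + 2 * X t w.

(** Every recursive call lowers the height, so [(ht v).+1] is enough fuel. On roots the final 1 is
    reached only at simple roots other than [alpha s]. The choice of the descent [t] is justified by
    [mu_ruleE]. *)
Fixpoint mu_fuel n s v : int :=
  if n isn't n'.+1 then 0
  else if v == alpha s then 2
  else if 0 < pr s v then 0
  else if [pick t | (0 < pr t v) && (v != alpha t)] is Some t
       then mu_rule (mu_fuel n') s t v
       else 1.

Definition mu s v := mu_fuel (ht v).+1 s v.

Lemma mu_fuelE n s v : Phi v -> (ht v < n)%N -> mu_fuel n s v = mu s v.
Proof.
suff st m k w u : Phi w -> (ht w < m)%N -> (ht w < k)%N ->
    mu_fuel m u w = mu_fuel k u w.
  by move=> Pv lv; apply: st.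
elim: m k w u => // m IHm [|k] // w u Pw lm lk /=.
case: ifP => // /eqP nwu; case: ifP => // /negbT; rewrite -leNgt => puw.
case: pickP => // t /andP[ptw /eqP nwt].
have Pt : Phi (refl t w) by exact: Phi_refl.
have ht_t := ht_refl Pw Pt.
rewrite /mu_rule (IHm k) //; try lia.
case: ifP => // /negbFE ut.
have tu : adj t u by rewrite adj_sym.
rewrite (IHm k (refl t w) t) //; try lia.
case: ifP => // pu.
have Pu : Phi (refl u (refl t w)).
  apply: Phi_refl => // e.
  have := f_equal (pr u) e; have := f_equal (pr t) e.
  rewrite pr_refl_same pr_refl_adj // pr_alpha_adj // pr_alpha_same; lia.
have ht_u := ht_refl Pt Pu.
by congr (2 * _); apply: IHm => //; lia.
Qed.

Lemma mu_same s : mu s (alpha s) = 2.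
Proof. by rewrite /mu /= eqxx. Qed.

Lemma mu_simple s t : s != t -> mu s (alpha t) = 1.
Proof.
move=> st; rewrite /mu /= ltNge pr_alpha_le0 //=.
case: eqP => [/alpha_inj e|_]; first by rewrite e eqxx in st.
case: pickP => // r /andP[pr0 /eqP nr].
case: (eqVneq r t) => [e|rt]; first by case: nr; rewrite e.
by have := pr_alpha_le0 rt; lia.
Qed.

Lemma mu_pos s v : 0 < pr s v -> v <> alpha s -> mu s v = 0.
Proof. by move=> p /eqP/negbTE n; rewrite /mu /= n p. Qed.

Lemma mu_pick s t v : Phi v -> pr s v <= 0 -> 0 < pr t v -> v <> alpha t ->
  exists r, [/\ 0 < pr r v, v <> alpha r & mu s v = mu_rule mu s r v].
Proof.
move=> Pv ps pt nt; rewrite {1}/mu /=.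
case: eqP => [e|_]; first by move: ps; rewrite e pr_alpha_same.
rewrite ltNge ps /=; case: pickP => [r /andP[p /eqP nr]|/(_ t)]; last first.
  by rewrite pt; move/eqP: nt => ->.
exists r; split => //.
have Pr : Phi (refl r v) by exact: Phi_refl.
have hr := ht_refl Pv Pr.
rewrite /mu_rule mu_fuelE //; last by lia.
case: ifP => // /negbFE sr.
have rs : adj r s by rewrite adj_sym.
rewrite (@mu_fuelE _ r (refl r v)) //; last by lia.
case: ifP => // psw.
rewrite mu_fuelE //.
  apply: Phi_refl => // e.
  have := f_equal (pr s) e; have := f_equal (pr r) e.
  rewrite pr_refl_same pr_refl_adj // pr_alpha_adj // pr_alpha_same; lia.
have Ps : Phi (refl s (refl r v)).
  apply: Phi_refl => // e.
  have := f_equal (pr s) e; have := f_equal (pr r) e.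
  rewrite pr_refl_same pr_refl_adj // pr_alpha_adj // pr_alpha_same; lia.
have := ht_refl Pr Ps; lia.
Qed.

Lemma mu_rule_perp X s t v : ~~ adj s t -> mu_rule X s t v = X s (refl t v).
Proof. by rewrite /mu_rule => ->. Qed.

Lemma mu_rule_lt X s t v : adj s t -> 0 < pr s v + pr t v ->
  mu_rule X s t v = 2 * X t (refl s (refl t v)).
Proof. by move=> st p; rewrite /mu_rule st /= pr_refl_adj ?p // adj_sym. Qed.

Lemma mu_rule_eq X s t v : adj s t -> pr s v + pr t v = 0 ->
  mu_rule X s t v = 2 * X t (refl t v) - X s (refl t v).
Proof.
by move=> st p; rewrite /mu_rule st /= pr_refl_adj ?p ?ltxx ?eqxx // adj_sym.
Qed.

Lemma mu_rule_gt X s t v : adj s t -> pr s v + pr t v < 0 ->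
  mu_rule X s t v = X s (refl t v) + 2 * X t (refl t v).
Proof.
move=> st p; rewrite /mu_rule st /= pr_refl_adj ?ltNge ?(ltW p) ?lt_eqF //.
by rewrite adj_sym.
Qed.

(** * Independence of [mu] from the chosen descent *)

Section Consistency.
Variable h : nat.
Hypothesis mu_ruleIH : forall s t v, Phi v -> (ht v < h)%N ->
  pr s v <= 0 -> 0 < pr t v -> v <> alpha t -> mu s v = mu_rule mu s t v.

Section Generic.
Variable x : T.
(** Reflections in vertices other than [x] fix the coordinate at [x]. So they never lead from such a
    root to a simple root [alpha u] with [u != x], and the rules apply along the whole path without
    exceptional cases. *)
Let G v := Phi v /\ v x != 0.

Lemma G_neq u v : G v -> u != x -> v <> alpha u.
Proof. by move=> [_ vx] ux e; move: vx; rewrite e ffunE [x == u]eq_sym (negbTE ux). Qed.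

Lemma G_refl u v : u != x -> G v -> G (refl u v).
Proof.
move=> ux Gv; split; first exact: (Phi_refl (proj1 Gv) (G_neq Gv ux)).
have xu : x != u by rewrite eq_sym.
by rewrite refl_other //; case: Gv.
Qed.

Lemma G_ht u v : u != x -> G v -> (ht (refl u v))%:Z = (ht v)%:Z - pr u v.
Proof.
by move=> ux Gv; rewrite ht_refl //; case: Gv (G_refl ux Gv) => // ? _ [].
Qed.

Lemma G_perp s t v : G v -> (ht v < h)%N -> t != x -> s != x ->
  s != t -> ~~ adj s t -> 0 < pr t v -> mu s v = mu s (refl t v).
Proof.
move=> Gv hv tx sx st nst pt; have Gt := G_refl tx Gv.
have [ps|ps] := leP (pr s v) 0.
  rewrite (@mu_ruleIH s t) ?mu_rule_perp //; last exact: G_neq.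
  by case: Gv.
rewrite !mu_pos // ?pr_refl_perp //; try exact: G_neq.
by rewrite adj_sym.
Qed.

Lemma G_lt s t v : G v -> (ht v < h)%N -> t != x ->
  adj s t -> pr s v <= 0 -> 0 < pr t v -> 0 < pr s v + pr t v ->
  mu s v = 2 * mu t (refl s (refl t v)).
Proof.
move=> Gv hv tx st ps pt p; rewrite (@mu_ruleIH s t) ?mu_rule_lt //.
- by case: Gv.
- exact: G_neq.
Qed.

Lemma G_eq s t v : G v -> (ht v < h)%N -> t != x ->
  adj s t -> pr s v <= 0 -> 0 < pr t v -> pr s v + pr t v = 0 ->
  mu s v = 2 * mu t (refl t v) - mu s (refl t v).
Proof.
move=> Gv hv tx st ps pt p; rewrite (@mu_ruleIH s t) ?mu_rule_eq //.
- by case: Gv.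
- exact: G_neq.
Qed.

Lemma G_gt s t v : G v -> (ht v < h)%N -> t != x ->
  adj s t -> pr s v <= 0 -> 0 < pr t v -> pr s v + pr t v < 0 ->
  mu s v = mu s (refl t v) + 2 * mu t (refl t v).
Proof.
move=> Gv hv tx st ps pt p; rewrite (@mu_ruleIH s t) ?mu_rule_gt //.
- by case: Gv.
- exact: G_neq.
Qed.

Variables (s t r : T) (v : vec).
Hypotheses (sx : s != x) (tx : t != x) (rx : r != x).
Hypotheses (st : s != t) (sr : s != r) (tr : t != r).
Hypotheses (Gv : G v) (hv : (ht v <= h)%N).
Hypotheses (ps : pr s v <= 0) (pt : 0 < pr t v) (prv : 0 < pr r v).

Ltac solve_G := repeat (apply: G_refl => //).

(* [prE] stands for the rewrite rules evaluating the pairings of reflected vectors. *)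
Ltac side prE :=
  first [assumption | match goal with
  | |- is_true (ht _ < h)%N =>
      rewrite -ltz_nat !G_ht; [|solve [solve_G | assumption] ..];
      rewrite ?prE; move: hv; rewrite -lez_nat; zlia
  | |- G _ => solve_G
  | |- _ => rewrite ?prE; zlia
  end].

(** Type A_3 with [s] in the middle. Both sides are expanded until only values at common lower roots
    remain; the signs of the pairings at the intermediate roots decide which rule applies. The roles
    of [t] and [r] are symmetric, and [pr r v <= pr t v] breaks the tie. *)
Lemma center_generic : adj s t -> adj s r -> ~~ adj t r -> pr r v <= pr t v ->
  mu_rule mu s t v = mu_rule mu s r v.
Proof.
move=> ast asr natr le_rt.
have ats : adj t s by rewrite adj_sym.
have ars : adj r s by rewrite adj_sym.
have nart : ~~ adj r t by rewrite adj_sym.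
have rt : r != t by rewrite eq_sym.
have prE := (pr_refl_same, (fun w => pr_refl_adj w ast),
  (fun w => pr_refl_adj w asr), (fun w => pr_refl_adj w ats),
  (fun w => pr_refl_adj w ars), (fun w => pr_refl_perp w tr nart),
  (fun w => pr_refl_perp w rt natr)).
have dE : refl r (refl t v) = (refl t (refl r v)) by rewrite reflC.
have rsd : refl s (refl r (refl s (refl t v))) = refl r (refl s (refl t (refl r v))).
  by rewrite -dE -refl_braid.
have tsd : refl s (refl t (refl s (refl r v))) = refl t (refl s (refl t (refl r v))).
  by rewrite -refl_braid.
have [lt_ar|gt_ar|eq_ar] := ltgtP (- pr s v) (pr r v).
- rewrite (@mu_rule_lt mu s t); [|side prE ..].
  rewrite (@mu_rule_lt mu s r); [|side prE ..].
  rewrite (@G_perp t r (refl s (refl t v))); [|side prE ..].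
  rewrite (@G_lt t s (refl r (refl s (refl t v)))); [|side prE ..].
  rewrite (@G_perp r t (refl s (refl r v))); [|side prE ..].
  rewrite (@G_lt r s (refl t (refl s (refl r v)))); [|side prE ..].
  by rewrite rsd tsd reflC.
- rewrite (@mu_rule_gt mu s r); [|side prE ..].
  rewrite (@G_perp r t (refl r v)); [|side prE ..].
  have [lt_at|gt_at|eq_at] := ltgtP (- pr s v) (pr t v).
  + rewrite (@mu_rule_lt mu s t); [|side prE ..].
    rewrite (@G_perp t r (refl s (refl t v))); [|side prE ..].
    rewrite (@G_gt t s (refl r (refl s (refl t v)))); [|side prE ..].
    rewrite rsd.
    rewrite (@G_lt r s (refl t (refl r v))); [|side prE ..].
    rewrite (@G_lt s t (refl r v)); [|side prE ..].
    rewrite (@G_perp t r (refl s (refl t (refl r v)))); [|side prE ..].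
    ring.
  + rewrite (@mu_rule_gt mu s t); [|side prE ..].
    rewrite (@G_perp t r (refl t v)); [|side prE ..].
    have [lt_d|gt_d|eq_d] := ltgtP (pr s v + pr t v + pr r v) 0.
    * rewrite (@G_gt s r (refl t v)); [|side prE ..].
      rewrite (@G_gt s t (refl r v)); [|side prE ..].
      rewrite dE; ring.
    * rewrite (@G_lt s r (refl t v)); [|side prE ..].
      rewrite (@G_lt s t (refl r v)); [|side prE ..].
      rewrite dE.
      rewrite (@G_gt t s (refl t (refl r v))); [|side prE ..].
      rewrite (@G_gt r s (refl t (refl r v))); [|side prE ..].
      ring.
    * rewrite (@G_eq s r (refl t v)); [|side prE ..].
      rewrite (@G_eq s t (refl r v)); [|side prE ..].
      rewrite dE; ring.
  + rewrite (@mu_rule_eq mu s t); [|side prE ..].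
    rewrite (@G_perp t r (refl t v)); [|side prE ..].
    rewrite (@G_lt s r (refl t v)); [|side prE ..].
    rewrite dE.
    rewrite (@G_gt t s (refl t (refl r v))); [|side prE ..].
    rewrite (@G_eq r s (refl t (refl r v))); [|side prE ..].
    rewrite (@G_lt s t (refl r v)); [|side prE ..].
    ring.
- rewrite (@mu_rule_eq mu s r); [|side prE ..].
  rewrite (@G_perp r t (refl r v)); [|side prE ..].
  rewrite (@G_lt s t (refl r v)); [|side prE ..].
  have [lt_at|gt_at|eq_at] := ltgtP (- pr s v) (pr t v); last 1 first.
  + rewrite (@mu_rule_eq mu s t); [|side prE ..].
    rewrite (@G_perp t r (refl t v)); [|side prE ..].
    rewrite (@G_lt s r (refl t v)); [|side prE ..].
    rewrite dE.
    rewrite (@G_eq t s (refl t (refl r v))); [|side prE ..].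
    rewrite (@G_eq r s (refl t (refl r v))); [|side prE ..].
    ring.
  + rewrite (@mu_rule_lt mu s t); [|side prE ..].
    rewrite (@G_perp t r (refl s (refl t v))); [|side prE ..].
    rewrite (@G_eq t s (refl r (refl s (refl t v)))); [|side prE ..].
    rewrite rsd.
    rewrite (@G_lt r s (refl t (refl r v))); [|side prE ..].
    rewrite (@G_perp t r (refl s (refl t (refl r v)))); [|side prE ..].
    ring.
  + by zlia.
Qed.

(** Type A_3 with [r] in the middle; [e1], [e2] and [e3] identify the roots in which the two
    descents end. *)
Lemma path_generic : ~~ adj s t -> adj s r -> adj t r ->
  mu_rule mu s t v = mu_rule mu s r v.
Proof.
move=> nast asr atr.
have nats : ~~ adj t s by rewrite adj_sym.
have ars : adj r s by rewrite adj_sym.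
have art : adj r t by rewrite adj_sym.
have ts : t != s by rewrite eq_sym.
have prE := (pr_refl_same, (fun w => pr_refl_adj w atr),
  (fun w => pr_refl_adj w asr), (fun w => pr_refl_adj w art),
  (fun w => pr_refl_adj w ars), (fun w => pr_refl_perp w ts nast),
  (fun w => pr_refl_perp w st nats)).
have e1 : refl r (refl t (refl s (refl r (refl t v)))) =
    refl s (refl r (refl t (refl s (refl r v)))).
  by rewrite !(reflC _ nats) (refl_braid _ atr) (refl_braid _ ars).
have e2 : refl t (refl s (refl r (refl t v))) = refl s (refl r (refl t (refl r v))).
  by rewrite (reflC _ nats) (refl_braid _ atr).
have e3 : refl t (refl r (refl t v)) = refl r (refl t (refl r v)) by rewrite refl_braid.
rewrite (@mu_rule_perp mu s t); [|side prE ..].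
have [lt_ar|gt_ar|eq_ar] := ltgtP (- pr s v) (pr r v).
- rewrite (@mu_rule_lt mu s r); [|side prE ..].
  rewrite (@G_lt s r (refl t v)); [|side prE ..].
  rewrite (@G_lt r t (refl s (refl r (refl t v)))); [|side prE ..].
  rewrite (@G_lt r t (refl s (refl r v))); [|side prE ..].
  rewrite (@G_perp t s (refl r (refl t (refl s (refl r v))))); [|side prE ..].
  by rewrite e1.
- rewrite (@mu_rule_gt mu s r); [|side prE ..].
  rewrite (@G_perp s t (refl r v)); [|side prE ..].
  rewrite (@G_lt r t (refl r v)); [|side prE ..].
  have [lt_d|gt_d|eq_d] := ltgtP (pr s v + pr t v + pr r v) 0.
  + rewrite (@G_gt s r (refl t v)); [|side prE ..].
    rewrite (@G_perp s t (refl r (refl t v))); [|side prE ..].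
    rewrite (@G_gt r t (refl r (refl t v))); [|side prE ..].
    rewrite (@G_gt s r (refl t (refl r v))); [|side prE ..].
    rewrite e3; ring.
  + rewrite (@G_lt s r (refl t v)); [|side prE ..].
    rewrite (@G_gt r t (refl s (refl r (refl t v)))); [|side prE ..].
    rewrite e2.
    rewrite (@G_lt s r (refl t (refl r v))); [|side prE ..].
    rewrite (@G_perp t s (refl r (refl t (refl r v)))); [|side prE ..].
    ring.
  + rewrite (@G_eq s r (refl t v)); [|side prE ..].
    rewrite (@G_perp s t (refl r (refl t v))); [|side prE ..].
    rewrite (@G_gt r t (refl r (refl t v))); [|side prE ..].
    rewrite (@G_eq s r (refl t (refl r v))); [|side prE ..].
    rewrite e3; ring.
- rewrite (@mu_rule_eq mu s r); [|side prE ..].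
  rewrite (@G_lt s r (refl t v)); [|side prE ..].
  rewrite (@G_eq r t (refl s (refl r (refl t v)))); [|side prE ..].
  rewrite e2.
  rewrite (@G_perp s t (refl r v)); [|side prE ..].
  rewrite (@G_lt s r (refl t (refl r v))); [|side prE ..].
  rewrite (@G_lt r t (refl r v)); [|side prE ..].
  rewrite (@G_perp t s (refl r (refl t (refl r v)))); [|side prE ..].
  ring.
Qed.

Lemma side_generic : adj s t -> ~~ adj s r -> ~~ adj t r ->
  mu_rule mu s t v = mu_rule mu s r v.
Proof.
move=> ast nasr natr.
have ats : adj t s by rewrite adj_sym.
have nars : ~~ adj r s by rewrite adj_sym.
have nart : ~~ adj r t by rewrite adj_sym.
have rs : r != s by rewrite eq_sym.
have rt : r != t by rewrite eq_sym.
have prE := (pr_refl_same, (fun w => pr_refl_adj w ast),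
  (fun w => pr_refl_adj w ats), (fun w => pr_refl_perp w rs nasr),
  (fun w => pr_refl_perp w sr nars), (fun w => pr_refl_perp w rt natr),
  (fun w => pr_refl_perp w tr nart)).
have dE : refl r (refl t v) = (refl t (refl r v)) by rewrite reflC.
rewrite (@mu_rule_perp mu s r); [|side prE ..].
have [lt_d|gt_d|eq_d] := ltgtP (pr s v + pr t v) 0.
- rewrite (@mu_rule_gt mu s t); [|side prE ..].
  rewrite (@G_perp t r (refl t v)); [|side prE ..].
  rewrite (@G_perp s r (refl t v)); [|side prE ..].
  rewrite (@G_gt s t (refl r v)); [|side prE ..].
  by rewrite dE.
- rewrite (@mu_rule_lt mu s t); [|side prE ..].
  rewrite (@G_perp t r (refl s (refl t v))); [|side prE ..].
  rewrite (@G_lt s t (refl r v)); [|side prE ..].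
  by rewrite (reflC _ nars) dE.
- rewrite (@mu_rule_eq mu s t); [|side prE ..].
  rewrite (@G_perp t r (refl t v)); [|side prE ..].
  rewrite (@G_perp s r (refl t v)); [|side prE ..].
  rewrite (@G_eq s t (refl r v)); [|side prE ..].
  by rewrite dE.
Qed.

Lemma perp_generic : ~~ adj s t -> ~~ adj s r ->
  mu_rule mu s t v = mu_rule mu s r v.
Proof.
move=> nast nasr.
have rt : r != t by rewrite eq_sym.
rewrite (@mu_rule_perp mu s t) //.
rewrite (@mu_rule_perp mu s r) //.
have [atr|natr] := boolP (adj t r).
  have art : adj r t by rewrite adj_sym.
  have prE := (pr_refl_same, (fun w => pr_refl_adj w atr),
    (fun w => pr_refl_adj w art)).
  rewrite (@G_perp s r (refl t v)); [|side prE ..].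
  rewrite (@G_perp s t (refl r (refl t v))); [|side prE ..].
  rewrite (@G_perp s t (refl r v)); [|side prE ..].
  rewrite (@G_perp s r (refl t (refl r v))); [|side prE ..].
  by rewrite refl_braid.
have nart : ~~ adj r t by rewrite adj_sym.
have prE := (pr_refl_same, (fun w => pr_refl_perp w rt natr),
  (fun w => pr_refl_perp w tr nart)).
rewrite (@G_perp s r (refl t v)); [|side prE ..].
rewrite (@G_perp s t (refl r v)); [|side prE ..].
by rewrite reflC.
Qed.

End Generic.

Section Special.
Variables (s t r : T) (v : vec).
Hypotheses (st : s != t) (sr : s != r) (tr : t != r).
Hypotheses (Pv : Phi v) (v0 : forall i, i \notin [:: s; t; r] -> v i = 0).
Hypotheses (ps : pr s v <= 0) (pt : 0 < pr t v) (prv : 0 < pr r v).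

Let uniq_str : uniq [:: s; t; r].
Proof. by rewrite /= !inE negb_or st sr tr. Qed.

Let norm_v : v s * pr s v + (v t * pr t v + v r * pr r v) = 2.
Proof.
by rewrite -(norm_supp Pv uniq_str v0) !big_cons big_nil addr0.
Qed.

Lemma valE i : v i = if i == s then v s else if i == t then v t else
  if i == r then v r else 0.
Proof.
case: eqP => [-> //|/eqP is_]; case: eqP => [-> //|/eqP it].
case: eqP => [-> //|/eqP ir]; apply: v0.
by rewrite !inE !negb_or is_ it ir.
Qed.

(** The norm and the sign conditions leave only the highest root of A_3. The value 2 is symmetric in
    [t] and [r], so exchanging them gives the independence. *)
Lemma center_special : adj s t -> adj s r -> ~~ adj t r ->
  mu_rule mu s t v = 2.
Proof.
move=> ast asr natr.
have ats : adj t s by rewrite adj_sym.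
have ars : adj r s by rewrite adj_sym.
have nart : ~~ adj r t by rewrite adj_sym.
have := pr_supp s uniq_str v0; have := pr_supp t uniq_str v0.
have := pr_supp r uniq_str v0.
rewrite !big_cons !big_nil !adj_irr ast asr ats ars (negbTE natr) (negbTE nart) /=.
move=> er et es.
have [xs xt xr] : [/\ v s = 1, v t = 1 & v r = 1].
  have := Phi_ge0 Pv s; have := Phi_ge0 Pv t; have := Phi_ge0 Pv r.
  move: norm_v ps pt prv; rewrite er et es; clear.
  move: (v s) (v t) (v r) => a b c Q *.
  have S : (a - b) ^+ 2 + (a - c) ^+ 2 + b ^+ 2 + c ^+ 2 = 2.
    by rewrite -[RHS]Q; ring.
  have b1 : b = 1 by nia.
  have c1 : c = 1 by nia.
  split=> //; nia.
rewrite xs xt xr in er et es.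
rewrite mu_rule_lt; [|by []|by rewrite et es].
suff -> : refl s (refl t v) = alpha r by rewrite mu_simple.
apply/ffunP => i; rewrite !ffunE pr_refl_adj // et es valE xs xt xr.
have [->|_] := eqVneq i s; first by rewrite (negbTE st) (negbTE sr).
by have [->|_] := eqVneq i t; [rewrite (negbTE tr)|case: eqP].
Qed.

Lemma path_special : ~~ adj s t -> adj s r -> adj t r ->
  mu_rule mu s t v = mu_rule mu s r v.
Proof.
move=> nast asr atr.
have nats : ~~ adj t s by rewrite adj_sym.
have ars : adj r s by rewrite adj_sym.
have art : adj r t by rewrite adj_sym.
have := pr_supp s uniq_str v0; have := pr_supp t uniq_str v0.
have := pr_supp r uniq_str v0.
rewrite !big_cons !big_nil !adj_irr atr asr art ars (negbTE nast) (negbTE nats) /=.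
move=> er et es.
have [xs xt xr] : [/\ v s = 0, v t = 1 & v r = 1].
  have := Phi_ge0 Pv s; have := Phi_ge0 Pv t; have := Phi_ge0 Pv r.
  move: norm_v ps pt prv; rewrite er et es; clear.
  move: (v s) (v t) (v r) => a b c Q *.
  have S : (a - c) ^+ 2 + (c - b) ^+ 2 + a ^+ 2 + b ^+ 2 = 2.
    by rewrite -[RHS]Q; ring.
  have b1 : b = 1 by nia.
  split=> //; nia.
rewrite xs xt xr in er et es.
rewrite mu_rule_perp // mu_rule_eq //; last by rewrite er es.
have -> : refl t v = alpha r.
  apply/ffunP => i; rewrite !ffunE et valE xs xt xr.
  have [->|_] := eqVneq i s; first by rewrite (negbTE st) (negbTE sr).
  by have [->|_] := eqVneq i t; [rewrite (negbTE tr)|case: eqP].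
have -> : refl r v = alpha t.
  apply/ffunP => i; rewrite !ffunE er valE xs xt xr.
  have [->|_] := eqVneq i s; first by rewrite (negbTE st) (negbTE sr).
  by have [->|_] := eqVneq i t; [rewrite (negbTE tr)|case: eqP].
by rewrite !mu_simple // eq_sym.
Qed.

(** A root with positive coordinates at both [t] and [r] would have disconnected support. *)
Lemma side_special : adj s t -> ~~ adj s r -> ~~ adj t r -> False.
Proof.
move=> ast nasr natr.
have ats : adj t s by rewrite adj_sym.
have nars : ~~ adj r s by rewrite adj_sym.
have nart : ~~ adj r t by rewrite adj_sym.
have := pr_supp s uniq_str v0; have := pr_supp t uniq_str v0.
have := pr_supp r uniq_str v0.
rewrite !big_cons !big_nil !adj_irr ast ats (negbTE nasr) (negbTE natr).
rewrite (negbTE nars) (negbTE nart) /=.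
have := Phi_ge0 Pv s; have := Phi_ge0 Pv t; have := Phi_ge0 Pv r.
move: norm_v ps pt prv => + + + + + + + er et es; rewrite er et es; clear.
move: (v s) (v t) (v r) => a b c Q *.
have S : 2 * c ^+ 2 + (a - b) ^+ 2 + a ^+ 2 + b ^+ 2 = 2 by rewrite -[RHS]Q; ring.
have c1 : c = 1 by nia.
have : b = 0 by nia.
nia.
Qed.

Lemma perp_special : ~~ adj s t -> ~~ adj s r ->
  mu_rule mu s t v = mu_rule mu s r v.
Proof.
move=> nast nasr.
have nats : ~~ adj t s by rewrite adj_sym.
have nars : ~~ adj r s by rewrite adj_sym.
have := pr_supp s uniq_str v0; have := pr_supp t uniq_str v0.
have := pr_supp r uniq_str v0.
rewrite !big_cons !big_nil !adj_irr (negbTE nasr) (negbTE nast) (negbTE nars).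
rewrite (negbTE nats) (adj_sym r t) /=.
have gs := Phi_ge0 Pv s; have gt := Phi_ge0 Pv t; have gr := Phi_ge0 Pv r.
case: ifP => atr er et es.
  have [xs xt xr] : [/\ v s = 0, v t = 1 & v r = 1].
    move: gs gt gr norm_v ps pt prv; rewrite er et es; clear.
    move: (v s) (v t) (v r) => a b c *.
    have -> : a = 0 by nia.
    split=> //; nia.
  rewrite xs xt xr in er et es.
  rewrite !mu_rule_perp //.
  have -> : refl t v = alpha r.
    apply/ffunP => i; rewrite !ffunE et valE xs xt xr.
    have [->|_] := eqVneq i s; first by rewrite (negbTE st) (negbTE sr).
    by have [->|_] := eqVneq i t; [rewrite (negbTE tr)|case: eqP].
  have -> : refl r v = alpha t.
    apply/ffunP => i; rewrite !ffunE er valE xs xt xr.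
    have [->|_] := eqVneq i s; first by rewrite (negbTE st) (negbTE sr).
    by have [->|_] := eqVneq i t; [rewrite (negbTE tr)|case: eqP].
  by rewrite !mu_simple // eq_sym.
exfalso; move: gs gt gr norm_v ps pt prv; rewrite er et es; clear.
move: (v s) (v t) (v r) => a b c *.
by nia.
Qed.

End Special.

Hypothesis adj_tri : forall s t r, adj s t -> adj t r -> ~~ adj s r.

Lemma mu_rule_indep s t r v : Phi v -> (ht v <= h)%N ->
  pr s v <= 0 -> 0 < pr t v -> 0 < pr r v ->
  mu_rule mu s t v = mu_rule mu s r v.
Proof.
move=> Pv hv ps pt prv.
have [-> //|tr] := eqVneq t r.
have rt : r != t by rewrite eq_sym.
have st : s != t by apply: contraTneq pt => <-; rewrite -leNgt.
have sr : s != r by apply: contraTneq prv => <-; rewrite -leNgt.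
(* Either the support of [v] contains a further vertex, or [v] is a root of the rank-three subsystem
   and is found from its norm. *)
have generic := @pickP _ (fun x => (x \notin [:: s; t; r]) && (v x != 0)).
case: generic => [x /andP[]|v0]; last first.
  have v0' i : i \notin [:: s; t; r] -> v i = 0.
    by move=> iN; have := v0 i; rewrite iN /= => /negbFE/eqP.
  have v1' i : i \notin [:: s; r; t] -> v i = 0.
    by move=> iN; apply: v0'; move: iN; rewrite !inE ![_ || (i == t)]orbC.
  have [ast|nast] := boolP (adj s t); have [asr|nasr] := boolP (adj s r).
  - have natr : ~~ adj t r by apply: adj_tri asr; rewrite adj_sym.
    have nart : ~~ adj r t by rewrite adj_sym.
    by rewrite (@center_special s t r) ?(@center_special s r t).
  - have [atr|natr] := boolP (adj t r); last by case: (@side_special s t r v).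
    by rewrite -(@path_special s r t v) // adj_sym.
  - have [atr|natr] := boolP (adj t r); first exact: path_special.
    by case: (@side_special s r t v) => //; rewrite adj_sym.
  - exact: perp_special.
rewrite !inE !negb_or ![x == _]eq_sym => /and3P[sx tx rx] vx.
have Gv : Phi v /\ v x != 0 by [].
have [ast|nast] := boolP (adj s t); have [asr|nasr] := boolP (adj s r).
- have natr : ~~ adj t r by apply: adj_tri asr; rewrite adj_sym.
  have nart : ~~ adj r t by rewrite adj_sym.
  have [le_rt|/ltW le_tr] := leP (pr r v) (pr t v).
    exact: (@center_generic x).
  by rewrite -(@center_generic x s r t v).
- have [atr|natr] := boolP (adj t r); last exact: (@side_generic x).
  by rewrite -(@path_generic x s r t v) // adj_sym.
- have [atr|natr] := boolP (adj t r); first exact: (@path_generic x).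
  by rewrite -(@side_generic x s r t v) // adj_sym.
- exact: (@perp_generic x).
Qed.

End Consistency.

Hypothesis adj_tri : forall s t r, adj s t -> adj t r -> ~~ adj s r.

Lemma mu_ruleE s t v : Phi v -> pr s v <= 0 -> 0 < pr t v -> v <> alpha t ->
  mu s v = mu_rule mu s t v.
Proof.
have [n le_n] := ubnP (ht v); elim: n => // n IHn in s t v le_n *.
move=> Pv ps pt nt; have [r [prv _ ->]] := mu_pick Pv ps pt nt.
by apply: (@mu_rule_indep n) => // s' t' w Pw hw *; apply: IHn.
Qed.

Lemma Phi_cases v : Phi v -> (exists s, v = alpha s) \/
  exists r, [/\ 0 < pr r v, v <> alpha r & Phi (refl r v)].
Proof.
case=> {v} [s|r v Pv prv]; first by left; exists s.
right; exists r; rewrite reflK pr_refl_same; split=> //; first by lia.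
move=> e; have := Phi_ge0 Pv r; have := f_equal (pr r) e.
rewrite pr_refl_same pr_alpha_same.
have := f_equal (fun w : vec => w r) e; rewrite refl_same ffunE eqxx; lia.
Qed.

Lemma refl_neq_alpha t v : Phi v -> refl t v <> alpha t.
Proof.
move=> Pv e; have := Phi_ge0 Pv t; have := f_equal (pr t) e.
rewrite pr_refl_same pr_alpha_same.
have := f_equal (fun w : vec => w t) e; rewrite refl_same ffunE eqxx; lia.
Qed.

Lemma refl_alpha_perp s t : s != t -> ~~ adj s t -> refl t (alpha s) = alpha s.
Proof.
move=> st nst; rewrite refl_fix // pr_alpha_perp 1?eq_sym //.
by rewrite adj_sym.
Qed.

Lemma refl_alpha_adj s t : adj s t -> refl t (alpha s) = refl s (alpha t).
Proof.
move=> st; have ts : adj t s by rewrite adj_sym.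
have nst := adj_neq st.
apply/ffunP => i; rewrite !ffunE !pr_alpha_adj //.
have [->|it] := eqVneq i t; first by rewrite eq_sym (negbTE nst).
by case: eqP.
Qed.

Lemma mu_perp s t v : s != t -> ~~ adj s t -> Phi v -> v <> alpha t ->
  mu s (refl t v) = mu s v.
Proof.
move=> st nst.
have nts : ~~ adj t s by rewrite adj_sym.
suff down w : Phi w -> w <> alpha t -> 0 < pr t w -> mu s w = mu s (refl t w).
  move=> Pv nv; have [p|p|p] := ltgtP (pr t v) 0.
  - have nv' := @refl_neq_alpha t v Pv.
    rewrite -[in RHS](reflK t v); apply: down => //; first exact: Phi_refl.
    by rewrite pr_refl_same; lia.
  - by rewrite -down.
  - by rewrite refl_fix.
move=> Pw nw pt; have [ps|ps] := leP (pr s w) 0.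
  by rewrite (mu_ruleE Pw ps pt) // mu_rule_perp.
have ts : t != s by rewrite eq_sym.
rewrite !mu_pos // ?pr_refl_perp // => e; last first.
  by move: pt; rewrite e pr_alpha_perp.
have : pr t (refl t w) = 0 by rewrite e pr_alpha_perp.
by rewrite pr_refl_same; lia.
Qed.

(** This settles the case of [tau_adj] where both pairings vanish, which [mu_rule] does not address.
    Without triangles, a descent [r] is adjacent to at most one of [s] and [t]. If it is adjacent to
    [s], both sides become twice a value at [refl t (refl s (refl r v))], and the induction applies
    to the pair [s], [r]. *)
Lemma mu_orth s t v : adj s t -> Phi v -> pr s v = 0 -> pr t v = 0 ->
  mu s v = mu t v.
Proof.
have [n le_n] := ubnP (ht v); elim: n => // n IHn in s t v le_n *.
move=> ast Pv ps pt.
have [[u vu]|[r [prv nr Prv]]] := Phi_cases Pv.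
  have su : s != u by apply/eqP => e; move: ps; rewrite vu e pr_alpha_same.
  have tu : t != u by apply/eqP => e; move: pt; rewrite vu e pr_alpha_same.
  by rewrite vu !mu_simple.
have sr : s != r by apply/eqP => e; move: prv; rewrite -e ps.
have tr : t != r by apply/eqP => e; move: prv; rewrite -e pt.
have hr := ht_refl Pv Prv.
wlog nart : s t ast ps pt sr tr / ~~ adj r t.
  move=> wl; have [art|nart] := boolP (adj r t); last exact: wl.
  apply/esym/wl => //; first by rewrite adj_sym.
  by apply: contraTN art => ars; apply: adj_tri ast.
have natr : ~~ adj t r by rewrite adj_sym.
have ats : adj t s by rewrite adj_sym.
have rt : r != t by rewrite eq_sym.
have [asr|nasr] := boolP (adj s r); last first.
  have nars : ~~ adj r s by rewrite adj_sym.
  rewrite -(mu_perp sr nasr Pv nr) -(mu_perp tr natr Pv nr).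
  by apply: IHn => //; rewrite ?pr_refl_perp //; lia.
have ars : adj r s by rewrite adj_sym.
have prE := (pr_refl_same, (fun w => pr_refl_adj w ast),
  (fun w => pr_refl_adj w asr), (fun w => pr_refl_adj w ats),
  (fun w => pr_refl_adj w ars), (fun w => pr_refl_perp w tr nart),
  (fun w => pr_refl_perp w rt natr)).
have ns : refl r v <> alpha s.
  by move=> e; have := f_equal (pr t) e; rewrite !prE pr_alpha_adj // pt.
have Ps := Phi_refl Prv ns; have hs := ht_refl Prv Ps.
have nt : refl s (refl r v) <> alpha t.
  move=> e; have := f_equal (pr t) e; have := f_equal (pr s) e.
  by rewrite !prE pr_alpha_same pr_alpha_adj // ps pt; lia.
have Pt := Phi_refl Ps nt; have ht' := ht_refl Ps Pt.
rewrite prE in hs; rewrite !prE in ht'.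
have e1 : mu s v = 2 * mu r (refl s (refl r v)).
  by rewrite (@mu_ruleE s r) ?ps // mu_rule_lt // ps add0r.
have e2 : mu t v = 2 * mu s (refl t (refl s (refl r v))).
  rewrite -(mu_perp tr natr Pv nr) (@mu_ruleE t s) ?prE ?ps ?pt ?add0r //.
  by rewrite mu_rule_lt // !prE ps pt !add0r.
rewrite e1 e2 -(mu_perp rt nart Ps nt); congr (2 * _).
apply: IHn => //; rewrite ?prE ?ps ?pt; lia.
Qed.

(** * The operators *)

(** Away from [alpha t] the operator [phi t] sends the constant 1 to 2, so the relations [tau_perp]
    and [tau_adj] take the same form for [mu] there; [mu] is handier in the recursion since it
    vanishes where [pr s v] is positive, except at [alpha s]. *)
Definition tau s v : int := 1 - mu s v.

Section Operators.
Variable R : comNzRingType.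
Implicit Types (f g : vec -> R).

(* The parameter y of the Lawrence-Krammer-Paris representation is 1/2, and the
   operators are scaled by 2 to make them integral. *)
Definition phi s f v : R :=
  if v == alpha s then 0
  else if pr s v < 0 then f v + f (refl s v)
  else f (refl s v) *+ 2.

Lemma phi_alpha s f : phi s f (alpha s) = 0.
Proof. by rewrite /phi eqxx. Qed.

Lemma phi_neg s f v : v <> alpha s -> pr s v < 0 ->
  phi s f v = f v + f (refl s v).
Proof. by rewrite /phi => /eqP/negbTE -> ->. Qed.

Lemma phi_pos s f v : v <> alpha s -> 0 <= pr s v ->
  phi s f v = f (refl s v) *+ 2.
Proof. by rewrite /phi leNgt => /eqP/negbTE -> /negbTE ->. Qed.

Lemma eq_phi s f g v : Phi v -> (forall w, Phi w -> f w = g w) ->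
  phi s f v = phi s g v.
Proof.
move=> Pv fg; rewrite /phi; case: eqP => // nv.
have Ps := Phi_refl Pv nv.
by case: ifP => _; rewrite !fg.
Qed.

Lemma phiD s f g v : phi s (fun w => f w + g w) v = phi s f v + phi s g v.
Proof. rewrite /phi; case: eqP => _; first by rewrite addr0. case: ifP => _; ring. Qed.

Lemma phiZ s c f v : phi s (fun w => c * f w) v = c * phi s f v.
Proof. rewrite /phi; case: eqP => _; first by rewrite mulr0. case: ifP => _; ring. Qed.

(** On a pair [v], [refl s v] of distinct roots [phi s] is a two by two matrix with eigenvalues 2
    and -1; on a fixed root it is multiplication by 2. *)
Lemma phi_quad s f v : Phi v -> v <> alpha s ->
  phi s (phi s f) v = phi s f v + f v *+ 2.
Proof.
move=> Pv nv; have nv' := @refl_neq_alpha s v Pv.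
have prv := pr_refl_same s v.
have [p|p] := ltP (pr s v) 0.
  by rewrite !(@phi_neg s _ v) // (@phi_pos s _ (refl s v)) ?reflK // prv; lia.
rewrite !(@phi_pos s _ v) //; case: (ltgtP (pr s v) 0) p => // [p|p] _.
  rewrite (@phi_neg s _ (refl s v)) ?reflK ?prv; [ring|done|lia].
by rewrite refl_fix // phi_pos ?p // refl_fix // mulrnDl.
Qed.

Lemma phi_comm s t f v : s != t -> ~~ adj s t -> Phi v ->
  phi s (phi t f) v = phi t (phi s f) v.
Proof.
move=> st nst Pv.
have ts : t != s by rewrite eq_sym.
have nts : ~~ adj t s by rewrite adj_sym.
have [->|/eqP ns] := eqVneq v (alpha s).
  rewrite phi_alpha phi_pos ?pr_alpha_perp //; last first.
    by move/alpha_inj/eqP; rewrite (negbTE st).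
  by rewrite refl_alpha_perp // phi_alpha mul0rn.
have [->|/eqP nt] := eqVneq v (alpha t).
  rewrite phi_alpha phi_pos ?pr_alpha_perp //; last first.
    by move/alpha_inj/eqP; rewrite (negbTE ts).
  by rewrite refl_alpha_perp // phi_alpha mul0rn.
have ns' : refl t v <> alpha s.
  by move=> e; case: ns; rewrite -(reflK t v) e refl_alpha_perp.
have nt' : refl s v <> alpha t.
  by move=> e; case: nt; rewrite -(reflK s v) e refl_alpha_perp.
have [p|p] := ltP (pr s v) 0; have [q|q] := ltP (pr t v) 0.
- rewrite !phi_neg ?pr_refl_perp // reflC //; ring.
- rewrite (phi_neg (s := s)) // !(phi_pos (s := t)) ?pr_refl_perp //.
  rewrite (phi_neg (s := s)) ?pr_refl_perp // reflC //; ring.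
- rewrite (phi_neg (s := t)) // !(phi_pos (s := s)) ?pr_refl_perp //.
  rewrite (phi_neg (s := t)) ?pr_refl_perp // reflC //; ring.
- by rewrite !phi_pos ?pr_refl_perp // reflC.
Qed.

End Operators.

Lemma rank2_roots s t v : adj s t -> Phi v ->
  (forall i, i \notin [:: s; t] -> v i = 0) ->
  [\/ v = alpha s, v = alpha t | v = refl t (alpha s)].
Proof.
move=> ast Pv v0; have ats : adj t s by rewrite adj_sym.
have st := adj_neq ast.
have uJ : uniq [:: s; t] by rewrite /= inE st.
have := norm_supp Pv uJ v0; rewrite !big_cons big_nil.
rewrite (pr_supp s uJ v0) (pr_supp t uJ v0) !big_cons !big_nil !adj_irr ast ats /=.
have := Phi_ge0 Pv s; have := Phi_ge0 Pv t.
have vE i : v i = if i == s then v s else if i == t then v t else 0.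
  case: eqP => [-> //|/eqP is_]; case: eqP => [-> //|/eqP it].
  by apply: v0; rewrite !inE negb_or is_ it.
move: vE; move: (v s) (v t) => a b vE b0 a0 Q.
have S : (a - b) ^+ 2 + a ^+ 2 + b ^+ 2 = 2 by rewrite -[RHS]Q; ring.
have [a1 b1] : a <= 1 /\ b <= 1 by split; nia.
have ab : [\/ a = 1 /\ b = 0, a = 0 /\ b = 1 | a = 1 /\ b = 1].
  have : a = 0 \/ a = 1 by lia.
  have : b = 0 \/ b = 1 by lia.
  case=> eb; case=> ea; rewrite ea eb in S *; try by [].
  - by constructor 1.
  - by constructor 2.
  - by constructor 3.
case: ab => [[ea eb]|[ea eb]|[ea eb]]; rewrite ea eb in vE.
- constructor 1; apply/ffunP => i; rewrite vE ffunE.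
  by case: eqP => // _; case: eqP.
- constructor 2; apply/ffunP => i; rewrite vE ffunE.
  by have [->|_] := eqVneq i s; [rewrite (negbTE st)|case: eqP].
- constructor 3; apply/ffunP => i; rewrite vE !ffunE pr_alpha_adj //.
  have [->|is_] := eqVneq i s; first by rewrite (negbTE st).
  by case: eqP.
Qed.

Section Operators2.
Variable R : comNzRingType.
Implicit Types (f g : vec -> R).

Lemma phi_braid_alpha s t f v : adj s t -> v = alpha s \/ v = refl t (alpha s) ->
  phi s (phi t (phi s f)) v = 0.
Proof.
move=> ast; have ats : adj t s by rewrite adj_sym.
case=> ->; first exact: phi_alpha.
rewrite phi_pos.
- by rewrite refl_alpha_adj // reflK phi_alpha mul0rn.
- move=> e; have := f_equal (pr t) e.
  by rewrite pr_refl_same !pr_alpha_adj.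
- by rewrite pr_refl_adj // pr_alpha_same pr_alpha_adj.
Qed.

Lemma phi_braid_alpha2 s t f v : adj s t -> v = alpha t ->
  phi s (phi t (phi s f)) v = 0.
Proof.
move=> ast ->; have ats : adj t s by rewrite adj_sym.
rewrite phi_neg ?pr_alpha_adj // => [|/alpha_inj e]; last first.
  by move: ast; rewrite e adj_irr.
rewrite phi_alpha add0r phi_pos.
- by rewrite (refl_alpha_adj ats) reflK phi_alpha mul0rn.
- move=> e; have := f_equal (pr s) e.
  by rewrite pr_refl_same !pr_alpha_adj.
- by rewrite pr_refl_adj // pr_alpha_same pr_alpha_adj.
Qed.

Ltac resolve_ifs := repeat match goal with
  |- context [if ?c then _ else _] =>
    first [have -> : c = true by zlia | have -> : c = false by zlia]
  end.

(** The roots supported on [s] and [t] are the three of type A_2, where both sides vanish. From any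
    other root the reflections never reach [alpha s] or [alpha t], and the signs of [pr s v],
    [pr t v] and their sum decide. *)
Lemma phi_braid s t f v : adj s t -> Phi v ->
  phi s (phi t (phi s f)) v = phi t (phi s (phi t f)) v.
Proof.
move=> ast Pv; have ats : adj t s by rewrite adj_sym.
have generic := @pickP _ (fun x => (x \notin [:: s; t]) && (v x != 0)).
case: generic => [x /andP[]|v0]; last first.
  have v0' i : i \notin [:: s; t] -> v i = 0.
    by move=> iN; have := v0 i; rewrite iN /= => /negbFE/eqP.
  have vst := rank2_roots ast Pv v0'.
  transitivity (0 : R).
    case: vst => e; [|exact: phi_braid_alpha2|].
      by apply: phi_braid_alpha => //; left.
    by apply: phi_braid_alpha => //; right.
  apply/esym; case: vst => e; [exact: phi_braid_alpha2| |].
    by apply: phi_braid_alpha => //; left.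
  by apply: phi_braid_alpha => //; right; rewrite e refl_alpha_adj.
rewrite !inE !negb_or ![x == _]eq_sym => /andP[sx tx] vx.
have Gv : Phi v /\ v x != 0 by [].
have phiE g u w : u != x -> Phi w /\ w x != 0 -> phi u g w =
    if pr u w < 0 then g w + g (refl u w) else g (refl u w) *+ 2.
  by move=> ux Gw; rewrite /phi; case: eqP => // /(G_neq Gw ux).
have prE := (pr_refl_same, (fun w => pr_refl_adj w ast),
  (fun w => pr_refl_adj w ats)).
rewrite !phiE; [|solve [assumption | repeat (apply: G_refl => //)] ..].
rewrite !prE.
have fix_s := refl_fix (s := s) (v := v).
have fix_t := refl_fix (s := t) (v := v).
have fix_ts := refl_fix (s := t) (v := refl s v).
have fix_st := refl_fix (s := s) (v := refl t v).
rewrite !prE in fix_ts fix_st.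
have braid := refl_braid v ast.
have [a0|a0|a0] := ltgtP (pr s v) 0; have [b0|b0|b0] := ltgtP (pr t v) 0.
- by resolve_ifs; rewrite -braid ?reflK; ring.
- have [c0|c0|c0] := ltgtP (pr s v + pr t v) 0; resolve_ifs.
  + by rewrite -braid ?reflK; ring.
  + by rewrite -braid ?reflK; ring.
  + have e : refl t (refl s v) = refl s v by apply: fix_ts; zlia.
    by rewrite -braid e ?reflK; ring.
- resolve_ifs; rewrite braid !fix_t // ?reflK; ring.
- have [c0|c0|c0] := ltgtP (pr s v + pr t v) 0; resolve_ifs.
  + by rewrite -braid ?reflK; ring.
  + by rewrite -braid ?reflK; ring.
  + have e : refl t (refl s v) = refl s v by apply: fix_ts; zlia.
    by rewrite -braid e ?reflK; ring.
- by resolve_ifs; rewrite -braid ?reflK; ring.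
- resolve_ifs; rewrite braid !fix_t // ?reflK; ring.
- resolve_ifs; rewrite -braid !fix_s // ?reflK; ring.
- resolve_ifs; rewrite -braid !fix_s // ?reflK; ring.
- by resolve_ifs; rewrite !(fix_s, fix_t).
Qed.

End Operators2.

Lemma tau_alpha s : tau s (alpha s) = -1.
Proof. by rewrite /tau mu_same. Qed.

Lemma tau_simple s t : s != t -> tau s (alpha t) = 0.
Proof. by move=> st; rewrite /tau mu_simple. Qed.

Lemma tau_pos s v : 0 < pr s v -> v <> alpha s -> tau s v = 1.
Proof. by move=> p n; rewrite /tau mu_pos. Qed.

Lemma tau_perp s t v : s != t -> ~~ adj s t -> Phi v ->
  phi t (tau s) v = tau s v *+ 2.
Proof.
move=> st nst Pv.
have [->|/eqP nt] := eqVneq v (alpha t); first by rewrite phi_alpha tau_simple.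
rewrite /phi; move/eqP/negbTE: (nt) => ->.
by rewrite /tau mu_perp // -mulr2n; case: ifP.
Qed.

Lemma tau_refl_adj s t : adj s t -> tau s (refl t (alpha s)) = 1.
Proof.
move=> ast; have ats : adj t s by rewrite adj_sym.
apply: tau_pos => [|e].
  by rewrite pr_refl_adj // pr_alpha_same pr_alpha_adj.
have := f_equal (pr t) e; by rewrite pr_refl_same pr_alpha_adj.
Qed.

Lemma tau_adj_alpha s t : adj s t -> phi t (tau s) (alpha s) = 0.
Proof.
move=> ast; have ats : adj t s by rewrite adj_sym.
rewrite phi_neg ?pr_alpha_adj // ?tau_alpha ?tau_refl_adj //.
by move/alpha_inj => e; move: ast; rewrite e adj_irr.
Qed.

(** This is the identity that [mu_rule] was made for: each nontrivial sign pattern is one of its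
    clauses, read at [refl t v] or [refl s v], and [mu_orth] covers the roots orthogonal to both. *)
Lemma tau_adj s t v : adj s t -> Phi v -> phi t (tau s) v = phi s (tau t) v.
Proof.
move=> ast Pv.
wlog le_ts : s t ast / pr t v <= pr s v.
  move=> wl; have [|/ltW] := leP (pr t v) (pr s v); first exact: wl.
  by move=> le; apply/esym/wl; rewrite // adj_sym.
have ats : adj t s by rewrite adj_sym.
have [->|/eqP ns] := eqVneq v (alpha s).
  by rewrite tau_adj_alpha // phi_alpha.
have [->|/eqP nt] := eqVneq v (alpha t).
  by rewrite tau_adj_alpha // phi_alpha.
have [->|/eqP nst] := eqVneq v (refl t (alpha s)).
  rewrite !phi_pos ?reflK; last 4 first.
  - move=> e; have := f_equal (pr t) e.
    by rewrite pr_refl_same pr_alpha_adj.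
  - by rewrite pr_refl_adj // pr_alpha_same pr_alpha_adj.
  - rewrite refl_alpha_adj // => e; have := f_equal (pr s) e.
    by rewrite pr_refl_same pr_alpha_adj.
  - by rewrite pr_refl_same pr_alpha_adj.
  by rewrite refl_alpha_adj // reflK !tau_alpha.
have nts : refl t v <> alpha s by move=> e; case: nst; rewrite -e reflK.
have nst' : refl s v <> alpha t.
  by move=> e; case: nst; rewrite refl_alpha_adj // -e reflK.
have Pt := Phi_refl Pv nt; have Ps := Phi_refl Pv ns.
have prt : pr s (refl t v) = pr s v + pr t v by rewrite pr_refl_adj.
have prs : pr t (refl s v) = pr t v + pr s v by rewrite pr_refl_adj.
have ntt := @refl_neq_alpha t v Pv; have nss := @refl_neq_alpha s v Pv.
have ptt := pr_refl_same t v; have pss := pr_refl_same s v.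
have [q|q|q] := ltgtP (pr t v) 0.
- rewrite (@phi_neg _ t); [|done ..].
  have [p|p|p] := ltgtP (pr s v) 0.
  + rewrite (@phi_neg _ s) /tau; [|done ..].
    rewrite (@mu_ruleE s t (refl t v)) // ?mu_rule_gt ?reflK //; try zlia.
    rewrite (@mu_ruleE t s (refl s v)) // ?mu_rule_gt ?reflK //; zlia.
  + rewrite (@phi_pos _ s); [|done|exact: ltW].
    rewrite (tau_pos p ns).
    have [r|r] := ltP 0 (pr s v + pr t v).
      by rewrite !tau_pos //; zlia.
    rewrite /tau (@mu_ruleE s t (refl t v)) // ?mu_rule_lt ?reflK //; zlia.
  + rewrite (@phi_pos _ s); [|done|by rewrite p].
    rewrite (refl_fix p) /tau.
    rewrite (@mu_ruleE s t (refl t v)) // ?mu_rule_eq ?reflK //; zlia.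
- rewrite (@phi_pos _ s); [|done|zlia].
  rewrite (@phi_pos _ t); [|done|zlia].
  by rewrite !tau_pos //; zlia.
- rewrite (@phi_pos _ s); [|done|zlia].
  rewrite (@phi_pos _ t); [|done|zlia].
  rewrite (refl_fix q); have [p|p|p] := ltgtP (pr s v) 0; try zlia.
    by rewrite !tau_pos //; zlia.
  by rewrite (refl_fix p) /tau (mu_orth ast).
Qed.

Lemma tau_adj2 s t v : adj s t -> Phi v ->
  phi s (phi t (tau s)) v = phi s (tau t) v + tau t v *+ 2.
Proof.
move=> ast Pv; have st := adj_neq ast.
have [->|/eqP ns] := eqVneq v (alpha s).
  by rewrite !phi_alpha tau_simple // eq_sym.
rewrite (@eq_phi _ s _ (phi s (tau t)) v Pv); last first.
  by move=> w Pw; apply: tau_adj.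
exact: phi_quad.
Qed.

(** * The deformed operators, their braid relations and their inverses *)

Section Psi.
Variables (R : comNzRingType) (x : R).
Implicit Types (f g : vec -> R).

Definition tauR s v : R := (tau s v)%:~R.

Definition psi s f v : R := phi s f v + x * f (alpha s) * tauR s v.

Lemma phi_intr s (f : vec -> int) v :
  phi s (fun w => (f w)%:~R) v = (phi s f v)%:~R :> R.
Proof.
rewrite /phi; case: ifP => // _; case: ifP => _; first by rewrite intrD.
by rewrite !mulr2n intrD.
Qed.

Lemma phi_psi s t f v : phi t (psi s f) v =
  phi t (phi s f) v + x * f (alpha s) * phi t (tauR s) v.
Proof. by rewrite /psi phiD phiZ. Qed.

Lemma eq_psi s f g v : Phi v -> (forall w, Phi w -> f w = g w) ->
  psi s f v = psi s g v.
Proof.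
move=> Pv fg; rewrite /psi (eq_phi s Pv fg) fg //; exact: Phi_alpha.
Qed.

Lemma psi_psi s t f v : psi t (psi s f) v =
  phi t (phi s f) v + x * f (alpha s) * phi t (tauR s) v
    + x * psi s f (alpha t) * tauR t v.
Proof. by rewrite {1}/psi phi_psi. Qed.

Lemma psi_comm s t f v : s != t -> ~~ adj s t -> Phi v ->
  psi s (psi t f) v = psi t (psi s f) v.
Proof.
move=> st nst Pv.
have ts : t != s by rewrite eq_sym.
have nts : ~~ adj t s by rewrite adj_sym.
have e (u w : T) : u != w -> ~~ adj u w ->
    psi u f (alpha w) = f (alpha w) *+ 2.
  move=> uw nuw; rewrite /psi phi_pos ?pr_alpha_perp //; last first.
    by move/alpha_inj/eqP; rewrite eq_sym (negbTE uw).
  by rewrite refl_alpha_perp 1?eq_sym 1?adj_sym // /tauR tau_simple // mulr0 addr0.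
rewrite !psi_psi !e // (phi_comm _ st) // !phi_intr !tau_perp // /tauR; ring.
Qed.

Lemma psi_braid s t f v : adj s t -> Phi v ->
  psi s (psi t (psi s f)) v = psi t (psi s (psi t f)) v.
Proof.
move=> ast Pv; have ats : adj t s by rewrite adj_sym.
have C1 (u w : T) : adj u w -> phi u (phi w (tauR u)) v =
    phi u (tauR w) v + tauR w v *+ 2.
  move=> uw; rewrite (@eq_phi _ _ _ (fun w' => (phi w (tau u) w')%:~R)) //.
    by rewrite phi_intr tau_adj2 // phi_intr intrD /tauR; ring.
  by move=> w' _; exact: phi_intr.
have nalpha (u w : T) : adj u w -> alpha w <> alpha u.
  by move=> uw /alpha_inj e; move: uw; rewrite e adj_irr.
have g1 (u w : T) : adj u w ->
    psi u f (alpha w) = f (alpha w) + f (refl u (alpha w)).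
  move=> uw; rewrite /psi phi_neg ?pr_alpha_adj //; last exact: nalpha.
  by rewrite /tauR tau_simple ?adj_neq // mulr0 addr0.
(* The terms in [x] cancel, as [tau u] is -1 at [alpha u] and 1 at [refl w (alpha u)]; hence no
   square of [x] arises in [expand]. *)
have h1 (u w : T) : adj u w -> psi w (psi u f) (alpha u) = f (alpha w) *+ 2.
  move=> uw; have wu : adj w u by rewrite adj_sym.
  rewrite {1}/psi phi_neg ?pr_alpha_adj //; last exact: nalpha.
  rewrite /tauR tau_simple ?adj_neq // mulr0 addr0.
  rewrite /psi phi_alpha /tauR tau_alpha tau_refl_adj //.
  rewrite phi_pos; last first.
  - by rewrite pr_refl_adj // pr_alpha_same pr_alpha_adj.
  - move=> e; have := f_equal (pr w) e; by rewrite pr_refl_same pr_alpha_adj.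
  by rewrite refl_alpha_adj // reflK; ring.
have expand (u w : T) : adj u w -> psi u (psi w (psi u f)) v =
   phi u (phi w (phi u f)) v + x * f (alpha u) * phi u (phi w (tauR u)) v
   + x * psi u f (alpha w) * phi u (tauR w) v
   + x * (f (alpha w) *+ 2) * tauR u v.
  move=> uw; rewrite {1}/psi h1 // phi_psi.
  rewrite (@eq_phi _ u (phi w (psi u f)) (fun w' => phi w (phi u f) w' +
     x * f (alpha u) * phi w (tauR u) w')) //; last first.
    by move=> w' _; exact: phi_psi.
  by rewrite phiD phiZ.
rewrite (expand s t ast) (expand t s ats) (C1 s t ast) (C1 t s ats).
rewrite (g1 s t ast) (g1 t s ats) (phi_braid _ ast Pv) (refl_alpha_adj ast).
have -> : phi s (tauR t) v = phi t (tauR s) v.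
  by rewrite !phi_intr tau_adj.
ring.
Qed.

End Psi.

Section PsiInv.
Variables (K : fieldType) (x : K).
Hypotheses (x0 : x != 0) (two0 : 2%:R != 0 :> K).
Implicit Types (f g : vec -> K).

(** At [alpha s] the operator [psi x s] multiplies by [- x], which gives back the value of the
    preimage there. Then [g] is [phi s] of the preimage, and it remains to invert [phi s] on each
    pair [v], [refl s v]. *)
Definition psi_inv s f v : K :=
  let g w := f w + f (alpha s) * tauR K s w in
  if v == alpha s then - f (alpha s) / x
  else if pr s v < 0 then g (refl s v) / 2%:R
  else if pr s v == 0 then g v / 2%:R
  else g (refl s v) - g v / 2%:R.

Lemma eq_psi_inv s f g v : Phi v -> (forall w, Phi w -> f w = g w) ->
  psi_inv s f v = psi_inv s g v.
Proof.
move=> Pv fg; rewrite /psi_inv (fg _ (Phi_alpha s)).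
case: ifP => // /eqP nv; have Ps := Phi_refl Pv nv.
by rewrite !fg.
Qed.

Lemma psi_invK s f v : Phi v -> psi x s (psi_inv s f) v = f v.
Proof.
move=> Pv; rewrite /psi.
have -> : psi_inv s f (alpha s) = - f (alpha s) / x by rewrite /psi_inv eqxx.
have [->|/eqP ns] := eqVneq v (alpha s).
  by rewrite phi_alpha /tauR tau_alpha; field.
have ns' := @refl_neq_alpha s v Pv.
have pE := pr_refl_same s v.
have [p|p|p] := ltgtP (pr s v) 0.
- rewrite phi_neg // /psi_inv; move/eqP/negbTE: (ns) => ->.
  move/eqP/negbTE: (ns') => ->.
  rewrite pE p ltNge oppr_ge0 (ltW p) /= oppr_eq0 lt_eqF // reflK.
  by field; rewrite x0.
- rewrite phi_pos ?(ltW p) // /psi_inv; move/eqP/negbTE: (ns') => ->.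
  rewrite pE oppr_lt0 p reflK.
  by field; rewrite x0.
- rewrite phi_pos ?p // refl_fix // /psi_inv; move/eqP/negbTE: (ns) => ->.
  rewrite p ltxx eqxx.
  by field; rewrite x0.
Qed.

Lemma psiK s f v : Phi v -> psi_inv s (psi x s f) v = f v.
Proof.
move=> Pv; rewrite /psi_inv.
have gE w : psi x s f w + psi x s f (alpha s) * tauR K s w = phi s f w.
  by rewrite /psi phi_alpha {2}/tauR tau_alpha; ring.
have [->|/eqP ns] := eqVneq v (alpha s).
  by rewrite /psi phi_alpha /tauR tau_alpha; field.
have ns' := @refl_neq_alpha s v Pv.
have pE := pr_refl_same s v.
rewrite !gE; have [p|p|p] := ltgtP (pr s v) 0.
- rewrite phi_pos ?reflK //; first by field.
  by rewrite pE oppr_ge0 ltW.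
- rewrite phi_neg //; last by rewrite pE oppr_lt0.
  rewrite phi_pos ?(ltW p) // reflK; by field.
- by rewrite phi_pos ?p // refl_fix //; field.
Qed.

End PsiInv.

(** * The action of words *)

Definition small_entry s t : option nat :=
  Some (if s == t then 1 else if adj s t then 3 else 2)%N.

Lemma small_entry_diag s : small_entry s s = Some 1%N.
Proof. by rewrite /small_entry eqxx. Qed.

Lemma small_entry_sym s t : small_entry s t = small_entry t s.
Proof. by rewrite /small_entry eq_sym adj_sym. Qed.

Lemma small_entry_offdiag s t m : s != t -> small_entry s t = Some m -> (2 <= m)%N.
Proof. by rewrite /small_entry => /negbTE -> [<-]; case: ifP. Qed.

Definition small_matrix : coxeter_matrix T :=
  CoxeterMatrix small_entry_diag small_entry_sym small_entry_offdiag.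

Definition eq_on_Phi (A : Type) (f g : vec -> A) := forall v, Phi v -> f v = g v.

Section Words.
Variables (R : comNzRingType) (x : R).
Implicit Types (f g : vec -> R) (u : seq T).

(** The first letter acts first, so that a left divisor acts before the rest of the word. *)
Definition opw u f : vec -> R := foldl (fun g s => psi x s g) f u.

Lemma opw_cat u u' f : opw (u ++ u') f = opw u' (opw u f).
Proof. exact: foldl_cat. Qed.

Lemma opw_rcons u s f : opw (rcons u s) f = psi x s (opw u f).
Proof. exact: foldl_rcons. Qed.

Lemma eq_opw u f g : eq_on_Phi f g -> eq_on_Phi (opw u f) (opw u g).
Proof.
elim: u f g => //= s u IHu f g fg; apply: IHu => v Pv.
exact: eq_psi.
Qed.

Lemma opw_cong u u' f : word_cong (artin_rel small_matrix id) u u' ->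
  eq_on_Phi (opw u f) (opw u' f).
Proof.
move=> uu'; elim: uu' f => {u u'} [u u' []|u|u u' _ IH|u v w _ IH1 _ IH2|].
- move=> s t m st [<-] f v Pv; rewrite (negbTE st); case: ifP => ast /=.
    by rewrite psi_braid.
  by rewrite (psi_comm x f st) // ast.
- by [].
- by move=> f v Pv; rewrite IH.
- by move=> f z Pz; rewrite IH1 // IH2.
- move=> u u' v v' _ IH1 _ IH2 f z Pz; rewrite !opw_cat IH2 //.
  exact: (eq_opw v' (IH1 f)) Pz.
Qed.

End Words.

Lemma opw_rmorph (R R' : comNzRingType) (h : {rmorphism R -> R'}) (x : R) u
    (f : vec -> R) v :
  h (opw x u f v) = opw (h x) u (h \o f) v.
Proof.
elim/last_ind: u v => // u s IHu v; rewrite !opw_rcons /psi /phi.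
rewrite rmorphD !rmorphM /tauR rmorph_int -!IHu; congr (_ + _).
case: ifP => _; first by rewrite rmorph0.
by case: ifP => _; rewrite ?rmorphD ?rmorphMn !IHu.
Qed.

Section Inverse.
Variables (K : fieldType) (x : K).
Hypotheses (x0 : x != 0) (two0 : 2%:R != 0 :> K).

Definition opw_inv (u : seq T) (f : vec -> K) : vec -> K :=
  foldl (fun g s => psi_inv x s g) f (rev u).

Lemma eq_opw_inv u f g : eq_on_Phi f g -> eq_on_Phi (opw_inv u f) (opw_inv u g).
Proof.
rewrite /opw_inv; elim: (rev u) f g => //= s {}u IHu f g fg; apply: IHu => v Pv.
exact: eq_psi_inv.
Qed.

Lemma opw_invK u f : eq_on_Phi (opw x u (opw_inv u f)) f.
Proof.
elim: u f => //= s u IHu f v Pv.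
rewrite /opw_inv rev_cons foldl_rcons -/(opw_inv u f).
rewrite -/(opw x u _) -[RHS]IHu //; apply: eq_opw Pv => w Pw.
exact: psi_invK.
Qed.

Lemma opwK u f : eq_on_Phi (opw_inv u (opw x u f)) f.
Proof.
elim/last_ind: u f => //= u s IHu f v Pv.
rewrite opw_rcons /opw_inv rev_rcons /= -/(opw_inv u _).
rewrite -[RHS]IHu //; apply: eq_opw_inv Pv => w Pw.
exact: psiK.
Qed.

End Inverse.

(** * Positivity at x = 0 *)

Lemma psi0 s (f : vec -> int) v : psi 0 s f v = phi s f v.
Proof. by rewrite /psi !mul0r addr0. Qed.

Lemma phi_mono s (f g : vec -> int) v : Phi v -> (forall w, Phi w -> f w <= g w) ->
  phi s f v <= phi s g v.
Proof.
move=> Pv fg; rewrite /phi; case: ifP => // /eqP nv.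
have fv := fg _ Pv; have fs := fg _ (Phi_refl Pv nv).
by case: ifP => _; lia.
Qed.

Lemma opw_mono u (f g : vec -> int) v : Phi v ->
  (forall w, Phi w -> f w <= g w) -> opw 0 u f v <= opw 0 u g v.
Proof.
move=> Pv fg; elim/last_ind: u v Pv => [|u s IHu] v Pv; first exact: fg.
rewrite !opw_rcons !psi0; exact: phi_mono.
Qed.

Lemma opw_zero u v : opw 0 u (fun _ => 0 : int) v = 0.
Proof.
elim/last_ind: u v => // u s IHu v; rewrite opw_rcons psi0 /phi !IHu.
by rewrite addr0 mul0rn !if_same.
Qed.

Lemma opw_ge0 u (f : vec -> int) v : Phi v ->
  (forall w, Phi w -> 0 <= f w) -> 0 <= opw 0 u f v.
Proof. by move=> Pv f0; rewrite -[X in X <= _](opw_zero u v); apply: opw_mono. Qed.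

(* A lower bound for the action of a commuting family l: the letters z of l with
   pr z v < 0 may be used or skipped. *)
Lemma opw_commuting_ge l (f : vec -> int) v w :
  uniq l -> {in l &, forall z z', ~~ adj z z'} ->
  (forall w, Phi w -> 0 <= f w) -> Phi v -> {in l, forall z, v <> alpha z} ->
  (forall z, z \notin l -> w z = v z) ->
  {in l, forall z, w z = v z - pr z v \/ (w z = v z /\ pr z v <= 0)} ->
  f w <= opw 0 l f v.
Proof.
move=> + + f0; elim/last_ind: l v => [|l z IHl] v ul nl Pv nv wout win.
  by suff -> : w = v by []; apply/ffunP => z; apply: wout.
move: ul; rewrite rcons_uniq => /andP[zl ul].
have zin : z \in rcons l z by rewrite mem_rcons mem_head.
have lin y : y \in l -> y \in rcons l z by rewrite mem_rcons inE orbC => ->.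
have nvz : v <> alpha z by apply: nv.
have prl y : y \in l -> pr y (refl z v) = pr y v.
  move=> yl; apply: pr_refl_perp; last by apply: nl => //; apply: lin.
  by apply: contraNneq zl => <-.
have nl' : {in l &, forall y y', ~~ adj y y'}.
  by move=> y y' yl y'l; apply: nl; apply: lin.
have g0 y : Phi y -> 0 <= opw 0 l f y by move=> Py; apply: opw_ge0.
rewrite opw_rcons psi0.
case: (win z zin) => [wz|[wz pz]].
  apply: (@le_trans _ _ (opw 0 l f (refl z v))).
    apply: IHl => //.
    - exact: Phi_refl.
    - move=> y yl e; apply: (nv y (lin _ yl)).
      rewrite -(reflK z v) e refl_alpha_perp //.
        by apply: contraNneq zl => <-.
      by apply: nl => //; apply: lin.
    - move=> y yl; have [->|yz] := eqVneq y z; first by rewrite refl_same.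
      by rewrite refl_other // wout // mem_rcons inE negb_or yz.
    - move=> y yl; rewrite prl // refl_other; last first.
        by apply: contraNneq zl => <-.
      exact/win/lin.
  have := g0 _ Pv; have := g0 _ (Phi_refl Pv nvz).
  rewrite /phi; move/eqP/negbTE: nvz => ->.
  by case: ifP => _; lia.
apply: (@le_trans _ _ (opw 0 l f v)).
  apply: IHl => //.
  - by move=> y yl; apply/nv/lin.
  - move=> y yl; have [-> //|yz] := eqVneq y z.
    by rewrite wout // mem_rcons inE negb_or yz.
  - by move=> y yl; apply/win/lin.
have := g0 _ Pv; have := g0 _ (Phi_refl Pv nvz).
rewrite /phi; move/eqP/negbTE: (nvz) => ->.
have [p|p] := ltP (pr z v) 0; first by lia.
by rewrite refl_fix; lia.
Qed.

Definition delta s v : int := (v == alpha s)%:Z.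

Lemma phi_delta_perp s t c v : t != s -> ~~ adj s t -> Phi v ->
  phi s (fun w => c * delta t w) v = c *+ 2 * delta t v.
Proof.
move=> ts nst Pv; rewrite /phi; case: ifP => [/eqP ->|/eqP nv].
  rewrite /delta; case: eqP => [/alpha_inj e|_]; last by rewrite mulr0.
  by move: ts; rewrite e eqxx.
have nts : ~~ adj t s by rewrite adj_sym.
have e : (refl s v == alpha t) = (v == alpha t).
  apply/eqP/eqP => [e|->]; last exact: refl_alpha_perp.
  by rewrite -(reflK s v) e refl_alpha_perp.
rewrite /delta e; case: ifP => pv; last by case: eqP; lia.
by case: eqP => [ev|]; [move: pv; rewrite ev pr_alpha_perp // eq_sym|lia].
Qed.

(* Letters commuting with s only rescale the coordinate function of alpha s, and s
   kills it. *)
Lemma opw_delta_commuting l s : s \in l -> {in l &, forall z z', ~~ adj z z'} ->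
  eq_on_Phi (opw 0 l (delta s)) (fun _ => 0).
Proof.
suff gen c f : eq_on_Phi f (fun w => c * delta s w) -> s \in l ->
    {in l &, forall z z', ~~ adj z z'} -> eq_on_Phi (opw 0 l f) (fun _ => 0).
  by apply: (gen 1) => v _; rewrite mul1r.
elim: l c f => // z l IHl c f fE sl nl v Pv /=.
have [ez|zs] := eqVneq z s.
  rewrite -[RHS](opw_zero l v); apply: eq_opw Pv => w Pw; rewrite psi0.
  rewrite (eq_phi z Pw fE) ez /phi; case: ifP => // /eqP nw.
  have /eqP/negbTE ns := @refl_neq_alpha s w Pw.
  by rewrite /delta ns; move/eqP/negbTE: nw => ->; rewrite mulr0 mul0rn if_same.
have sl' : s \in l by move: sl; rewrite inE eq_sym (negbTE zs).
apply: (IHl (c *+ 2)) => //.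
- move=> w Pw; rewrite psi0 (eq_phi z Pw fE) phi_delta_perp //.
    by rewrite eq_sym.
  by apply: nl => //; rewrite inE ?eqxx ?sl' ?orbT.
- by move=> y y' yl y'l; apply: nl; rewrite inE ?yl ?y'l orbT.
Qed.

End SmallType.

(** * Alternating words in type A *)

Section Bricks.
Local Open Scope group_scope.
Variables (G : monoidType) (a : nat -> G).

(** Row [r] stands for the letter of index [r] in an alternating word whose two letters are products
    of commuting generators; [P] selects the generators that occur in it. *)
Definition bricks m n (P : nat -> nat -> bool) : G :=
  \prod_(0 <= r < m) \prod_(0 <= i < n | P i r) a i.

Lemma commute_prod (I : Type) (s : seq I) (P : pred I) (F : I -> G) x :
  (forall i, P i -> commute x (F i)) -> commute x (\prod_(i <- s | P i) F i).
Proof.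
move=> xF; elim/big_ind: _ => //; first exact: commute1.
by move=> y z xy xz; apply: commuteM.
Qed.

Lemma prod_slide (I : Type) (s : seq I) (P : pred I) (F F' : I -> G) d :
  (forall i, P i -> F i * d = d * F' i) ->
  (\prod_(i <- s | P i) F i) * d = d * \prod_(i <- s | P i) F' i.
Proof.
move=> FF'; elim/big_ind2: _ => //; first by rewrite mul1g mulg1.
by move=> x x' y y' xd yd; rewrite -mulgA yd !mulgA xd.
Qed.

Lemma row_recr n (P : pred nat) : \prod_(0 <= i < n.+1 | P i) a i =
  (\prod_(0 <= i < n | P i) a i) * (if P n then a n else 1).
Proof. by rewrite big_mkcond big_nat_recr //= -big_mkcond. Qed.

Lemma row_recl n (P : pred nat) : \prod_(0 <= i < n.+1 | P i) a i =
  (if P 0 then a 0 else 1) * (\prod_(0 <= i < n | P i.+1) a i.+1).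
Proof. by rewrite big_mkcond big_nat_recl //= -big_mkcond. Qed.

Lemma row_split n (P Q Q' : pred nat) :
  (forall i, (i < n)%N -> P i = Q i || Q' i) ->
  (forall i, (i < n)%N -> ~~ (Q i && Q' i)) ->
  (forall i j, (i < n)%N -> (j < n)%N -> Q i -> Q' j -> commute (a i) (a j)) ->
  \prod_(0 <= i < n | P i) a i =
  (\prod_(0 <= i < n | Q i) a i) * \prod_(0 <= i < n | Q' i) a i.
Proof.
elim: n => [|n IHn] PQ dQ cQ; first by rewrite !big_nil mulg1.
rewrite !row_recr IHn; first last.
- by move=> i j ln lj; apply: cQ; exact: leqW.
- by move=> i ln; apply: dQ; exact: leqW.
- by move=> i ln; apply: PQ; exact: leqW.
have := PQ n (ltnSn n); have := dQ n (ltnSn n).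
case Qn: (Q n); case Q'n: (Q' n) => //= _ ->; rewrite ?mulg1 ?mulgA //.
rewrite -!mulgA; congr (_ * _); apply/esym.
have -> // : commute (a n) (\prod_(0 <= i < n | Q' i) a i).
rewrite big_nat_cond; apply: commute_prod => i /andP[/andP[_ ln] Q'i].
by apply: cQ => //; exact: leqW.
Qed.

(** Every letter of [Q] moves to the front, past the letters of [Q'] in its own and in earlier
    rows. *)
Lemma bricks_split m n (P Q Q' : nat -> nat -> bool) :
  (forall i r, (i < n)%N -> (r < m)%N -> P i r = Q i r || Q' i r) ->
  (forall i r, (i < n)%N -> (r < m)%N -> ~~ (Q i r && Q' i r)) ->
  (forall i r j q, (i < n)%N -> (j < n)%N -> (r < m)%N -> (q <= r)%N ->
     Q i r -> Q' j q -> commute (a i) (a j)) ->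
  bricks m n P = bricks m n Q * bricks m n Q'.
Proof.
rewrite /bricks; elim: m => [|m IHm] PQ dQ cQ; first by rewrite !big_nil mulg1.
rewrite !big_nat_recr //= IHm; first last.
- by move=> i r j q *; apply: (cQ i r j q) => //; exact: leqW.
- by move=> i r ln lm; apply: dQ => //; exact: leqW.
- by move=> i r ln lm; apply: PQ => //; exact: leqW.
rewrite (@row_split n (P^~ m) (Q^~ m) (Q'^~ m)); first last.
- by move=> i j ln lj; exact: cQ.
- by move=> i ln; exact: dQ.
- by move=> i ln; exact: PQ.
rewrite -!mulgA; congr (_ * _); rewrite !mulgA; congr (_ * _).
set row := \prod_(0 <= i < n | Q i m) a i; set rows := \prod_(0 <= r < m) _.
have -> // : commute rows row.
rewrite /row big_nat_cond; apply: commute_prod => i /andP[/andP[_ ln] Qi].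
apply/commute_sym; rewrite /rows big_nat_cond.
apply: commute_prod => q /andP[/andP[_ lq] _].
rewrite big_nat_cond; apply: commute_prod => j /andP[/andP[_ lj] Qj].
by apply: (cQ i m j q) => //; exact: ltnW.
Qed.

Section TypeA.
Variable n : nat.
Hypothesis a_far : forall i j, (i < n)%N -> (j < n)%N -> (i.+1 < j)%N ->
  commute (a i) (a j).
Hypothesis a_braid : forall i, (i.+1 < n)%N ->
  a i * a i.+1 * a i = a i.+1 * a i * a i.+1.

(** The letter [a i.+1] passes the factors before [a i], one braid relation turns it into [a i], and
    this passes the factors after [a i.+1]. *)
Lemma coxeter_shift k i : (i.+1 < k)%N -> (k <= n)%N ->
  a i.+1 * \prod_(0 <= j < k) a j = (\prod_(0 <= j < k) a j) * a i.
Proof.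
elim: k => // k IHk; rewrite ltnS leq_eqVlt => /orP[/eqP <-|lik] lk.
  rewrite !big_nat_recr //= !mulgA.
  have -> : a i.+1 * \prod_(0 <= j < i) a j = (\prod_(0 <= j < i) a j) * a i.+1.
    rewrite big_nat_cond; apply: commute_prod => j /andP[/andP[_ lj] _].
    apply/commute_sym/a_far; lia.
  by rewrite -!mulgA [a i.+1 * _]mulgA -a_braid ?mulgA.
rewrite big_nat_recr //= mulgA IHk //; last exact: ltnW.
rewrite -!mulgA; congr (_ * _); apply: a_far; lia.
Qed.

(* The bricks (i, r) of the word with parity [odd (i + r) == c] are cut along the
   diagonal i = r - c; the part on the right of it is pushed through the product
   a_0 ... a_(n-1), which shifts it one step to the left, and there it fits with the
   part on the left. *)
Lemma bricks_peel (c : bool) k : n = k.+1 ->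
  bricks n.+1 n (fun i r => odd (i + r) == c) =
  (\prod_(0 <= j < n) a j) * bricks n k (fun i r => odd (i + r) == ~~ c).
Proof.
move=> nk.
(* By parity [i + c - r] is even, so [B], [D] and [A] exhaust the word, and letters that must be
   exchanged have indices at least 2 apart. *)
pose B i r := (odd (i + r) == c) && (r + 2 <= i + c)%N.
pose DA i r := (odd (i + r) == c) && (i + c <= r)%N.
pose D i r := (i + c == r)%N.
pose A i r := (odd (i + r) == c) && (i + c + 2 <= r)%N.
have k_lt : (k < n)%N by rewrite nk.
have DAE : bricks n.+1 n DA = bricks n.+1 n D * bricks n.+1 n A.
  apply: bricks_split => [i r ln lr|i r ln lr|i r j q li lj lr lq].
  - rewrite /DA /D /A; lia.
  - rewrite /D /A; lia.
  - by rewrite /D /A => Dir Ajq; apply/commute_sym/a_far; lia.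
have PE : bricks n.+1 n (fun i r => odd (i + r) == c) =
    bricks n.+1 n B * bricks n.+1 n DA.
  apply: bricks_split => [i r ln lr|i r ln lr|i r j q li lj lr lq].
  - rewrite /B /DA; lia.
  - rewrite /B /DA; lia.
  - by rewrite /B /DA => Dir Ajq; apply/commute_sym/a_far; lia.
pose B' i r := B i.+1 r.
pose A' i r := A i r.+1.
have P'E : bricks n k (fun i r => odd (i + r) == ~~ c) =
    bricks n k B' * bricks n k A'.
  apply: bricks_split => [i r ln lr|i r ln lr|i r j q li lj lr lq].
  - rewrite /B' /A' /B /A; lia.
  - rewrite /B' /A' /B /A; lia.
  - by rewrite /B' /A' /B /A => Dir Ajq; apply/commute_sym/a_far; lia.
have DE : bricks n.+1 n D = \prod_(0 <= j < n) a j.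
  have row r : (r < n)%N -> \prod_(0 <= i < n | i == r) a i = a r.
    by move=> rn; rewrite big_nat1_eq rn.
  rewrite /bricks /D; case: (c).
    rewrite big_nat_recl //= [X in X * _]big1 ?mul1g; last by case.
    apply: eq_big_nat => r /andP[_ lr].
    by rewrite -[RHS]row //; apply: eq_bigl => i; rewrite addn1 eqSS.
  rewrite big_nat_recr //= [X in _ * X]big_nat_cond [X in _ * X]big1 ?mulg1.
    apply: eq_big_nat => r /andP[_ lr].
    by rewrite -[RHS]row //; apply: eq_bigl => i; rewrite addn0.
  by move=> i; lia.
have AE : bricks n.+1 n A = bricks n k A'.
  rewrite /bricks big_nat_recl //= [X in X * _]big1 ?mul1g; last first.
    by move=> i; rewrite /A; lia.
  apply: eq_big_nat => r /andP[_ lr]; rewrite {1}nk row_recr.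
  by rewrite ifF ?mulg1 // /A; lia.
have BE : bricks n.+1 n B * \prod_(0 <= j < n) a j =
    (\prod_(0 <= j < n) a j) * bricks n k B'.
  have shift i (li : (i.+1 < n)%N) := coxeter_shift li (leqnn n).
  move: (\prod_(0 <= j < n) a j) shift => d shift.
  rewrite /bricks big_nat_recr //=.
  rewrite [X in _ * X * _]big_nat_cond [X in _ * X * _]big1 ?mulg1.
    rewrite big_nat_cond [in RHS]big_nat_cond.
    apply: prod_slide => r /andP[/andP[_ lr] _].
    rewrite {1}nk row_recl {1}/B ifF ?mul1g; last by lia.
    rewrite /B' [in LHS]big_nat_cond [in RHS]big_nat_cond.
    apply: prod_slide => i /andP[/andP[_ li] _].
    by apply: shift; rewrite // nk.
  by move=> i; rewrite /B; lia.
by rewrite PE DAE P'E DE AE !mulgA BE.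
Qed.

End TypeA.

(** Both words spell the Garside element of type A_n: [bricks_peel] splits the same product off both
    and leaves the two words for n - 1, with their parities exchanged. *)
Lemma bricks_parity n :
  (forall i j, (i < n)%N -> (j < n)%N -> (i.+1 < j)%N -> commute (a i) (a j)) ->
  (forall i, (i.+1 < n)%N -> a i * a i.+1 * a i = a i.+1 * a i * a i.+1) ->
  bricks n.+1 n (fun i r => odd (i + r) == false) =
  bricks n.+1 n (fun i r => odd (i + r) == true).
Proof.
elim: n => [|n IHn] far braid.
  by rewrite /bricks; apply: eq_bigr => r _; rewrite !big_nil.
rewrite !(bricks_peel far braid _ (erefl _)) /= IHn //.
- by move=> i j li lj lij; apply: far => //; exact: leqW.
- by move=> i li; apply: braid; exact: leqW.
Qed.

Lemma prod_alt_word (I : Type) (F : I -> G) (x y : I) m :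
  \prod_(i <- alt_word x y m) F i =
  \prod_(0 <= r < m) (if odd r then F y else F x).
Proof.
elim: m x y => [|m IHm] x y; first by rewrite big_nil big_geq.
rewrite /= big_cons IHm big_nat_recl //=; congr (_ * _).
by apply: eq_bigr => r _; case: (odd r).
Qed.

(** The length [n.+1] is the Coxeter number of A_n; for n = m - 1 it is the label m. *)
Lemma alternating_typeA n :
  (forall i j, (i < n)%N -> (j < n)%N -> (i.+1 < j)%N -> commute (a i) (a j)) ->
  (forall i, (i.+1 < n)%N -> a i * a i.+1 * a i = a i.+1 * a i * a i.+1) ->
  let layer b := \prod_(0 <= i < n | odd i == b) a i in
  \prod_(b <- alt_word false true n.+1) layer b =
  \prod_(b <- alt_word true false n.+1) layer b.
Proof.
move=> far braid layer; rewrite !prod_alt_word.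
have := bricks_parity far braid; rewrite /bricks => e.
transitivity (\prod_(0 <= r < n.+1) \prod_(0 <= i < n | odd (i + r) == false) a i).
  by apply: eq_bigr => r _; case or: (odd r); apply: eq_bigl => i;
    rewrite oddD or; case: (odd i).
rewrite e; apply: eq_bigr => r _.
by case or: (odd r); apply: eq_bigl => i; rewrite oddD or; case: (odd i).
Qed.

End Bricks.

Section AlternatingProducts.
Local Open Scope group_scope.
Variable G : monoidType.
Implicit Types x y : G.

Lemma alt_word_commute x y z m : commute z x -> commute z y ->
  commute z (\prod_(a <- alt_word x y m) a).
Proof.
move=> zx zy; rewrite prod_alt_word; apply: commute_prod => r _.
by case: ifP.
Qed.

Lemma alt_word_mul x y x' y' m : commute x x' -> commute x y' ->
  commute y x' -> commute y y' ->
  \prod_(a <- alt_word (x * x') (y * y') m) a =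
  (\prod_(a <- alt_word x y m) a) * \prod_(a <- alt_word x' y' m) a.
Proof.
elim: m x y x' y' => [|m IHm] x y x' y' xx' xy' yx' yy'.
  by rewrite !big_nil mulg1.
rewrite /= !big_cons IHm // -!mulgA; congr (_ * _); rewrite !mulgA.
by congr (_ * _); apply: alt_word_commute; apply: commute_sym.
Qed.

Lemma alt_word_prod (I : finType) (X Y : I -> G) m :
  (forall i j, i != j ->
     [/\ commute (X i) (X j), commute (X i) (Y j) & commute (Y i) (Y j)]) ->
  (forall i, \prod_(a <- alt_word (X i) (Y i) m) a =
             \prod_(a <- alt_word (Y i) (X i) m) a) ->
  let PX := \prod_i X i in let PY := \prod_i Y i in
  \prod_(a <- alt_word PX PY m) a = \prod_(a <- alt_word PY PX m) a.
Proof.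
move=> XYC XYE /=.
have := index_enum_uniq I; elim: (index_enum I) => [|i s IHs] /=.
  by rewrite !big_nil.
case/andP=> i_s us; rewrite !big_cons.
have neq j : j \in s -> i != j by apply: contraTneq => <-.
have iP (Z Z' : I -> G) : (forall j, i != j -> commute (Z i) (Z' j)) ->
    commute (Z i) (\prod_(j <- s) Z' j).
  move=> ZZ'; rewrite big_seq; apply: commute_prod => j js.
  exact/ZZ'/neq.
have XX : commute (X i) (\prod_(j <- s) X j) by apply: iP => j /XYC[].
have XY : commute (X i) (\prod_(j <- s) Y j) by apply: iP => j /XYC[].
have YY : commute (Y i) (\prod_(j <- s) Y j) by apply: iP => j /XYC[].
have YX : commute (Y i) (\prod_(j <- s) X j).
  by apply: iP => j; rewrite eq_sym => /XYC[_ /commute_sym].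
by rewrite !alt_word_mul // IHs // XYE.
Qed.

End AlternatingProducts.

(** * Folding *)

Section Folding.
Variables (S : finType) (M : coxeter_matrix S) (ell : nat).
Implicit Types s t : S.

(* Words of length at most ell do not see the difference between an infinite entry
   and a sufficiently large one. *)
Definition fin_entry s t : nat := if M s t is Some m then m else ell.+2.
Definition block s t : nat := (fin_entry s t).-1.
(** A common multiple of all the numbers m - 1, so that for every pair of letters the columns can be
    cut into blocks of length m - 1. *)
Definition height : nat := \prod_(p : S * S | p.1 != p.2) block p.1 p.2.
Definition vertex : finType := (S * 'I_height)%type.

(* The vertices over s and t form a disjoint union of graphs A_(m-1), m being the
   entry of M at s, t. *)
Definition vadj : rel vertex := fun a b => [&& a.1 != b.1,
  (a.2.+1 == b.2 :> nat) || (b.2.+1 == a.2 :> nat)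
  & a.2 %/ block a.1 b.1 == b.2 %/ block a.1 b.1]%N.

Lemma block_sym s t : block s t = block t s.
Proof. by rewrite /block /fin_entry coxeter_sym. Qed.

Lemma block_gt0 s t : s != t -> (0 < block s t)%N.
Proof.
move=> st; rewrite /block /fin_entry; case E: (M s t) => [m|] //.
by have := coxeter_offdiag st E; case: m {E} => [|[]].
Qed.

Lemma height_gt0 : (0 < height)%N.
Proof. by apply: prodn_cond_gt0 => p; apply: block_gt0. Qed.

Lemma block_dvd s t : s != t -> (block s t %| height)%N.
Proof. by move=> st; rewrite /height (bigD1 (s, t)) //= dvdn_mulr. Qed.

Lemma vadj_sym : symmetric vadj.
Proof.
move=> [s y] [t z]; rewrite /vadj /= [t == s]eq_sym orbC [block t s]block_sym.
by rewrite [(z %/ _)%N == _]eq_sym.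
Qed.

Lemma vadj_irr : irreflexive vadj.
Proof. by move=> [s y]; rewrite /vadj /= eqxx. Qed.

(** The second coordinates of adjacent vertices differ by one, which excludes odd cycles. *)
Lemma vadj_tri a b c : vadj a b -> vadj b c -> ~~ vadj a c.
Proof.
move=> /and3P[_ ab _] /and3P[_ bc _]; apply/negP => /and3P[_ ac _].
by move: ab bc ac; lia.
Qed.

Definition column s : seq vertex := [seq (s, y) | y <- enum 'I_height].
Definition fold_word (u : seq S) : seq vertex := flatten [seq column s | s <- u].

Lemma fold_cat u v : fold_word (u ++ v) = fold_word u ++ fold_word v.
Proof. by rewrite /fold_word map_cat flatten_cat. Qed.

Lemma column_perp s : {in column s &, forall a b, ~~ vadj a b}.
Proof. by move=> a b /mapP[y _ ->] /mapP[z _ ->]; rewrite /vadj /= eqxx. Qed.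

Lemma column_uniq s : uniq (column s).
Proof. by rewrite map_inj_uniq ?enum_uniq // => y z []. Qed.

Lemma mem_column s a : (a \in column s) = (a.1 == s).
Proof.
case: a => t y /=; apply/mapP/eqP => [[z _ [-> _]] //|->].
by exists y; rewrite ?mem_enum.
Qed.

(** * Folding respects the Artin relations *)

Section Relation.
Local Open Scope group_scope.
Let G := artin_monoid (small_matrix vadj_sym).
Let gen (a : vertex) : G := artin_monoid_gen (small_matrix vadj_sym) a.

Let gen_commute a b : ~~ vadj a b -> commute (gen a) (gen b).
Proof.
move=> nab; have [->|ab] := eqVneq a b; first exact: erefl.
have : artin_rel (small_matrix vadj_sym) id [:: a; b] [:: b; a].
  apply: (@ArtinRel _ (small_matrix vadj_sym) _ id a b 2 ab).
  by rewrite /= /small_entry (negbTE ab) (negbTE nab).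
move/(word_cong_rel (R := _))/pm_wordP.
by rewrite !pm_wordE !big_cons !big_nil !mulg1.
Qed.

Let gen_braid a b : vadj a b -> gen a * gen b * gen a = gen b * gen a * gen b.
Proof.
move=> ab; have nab := adj_neq vadj_irr ab.
have : artin_rel (small_matrix vadj_sym) id [:: a; b; a] [:: b; a; b].
  apply: (@ArtinRel _ (small_matrix vadj_sym) _ id a b 3 nab).
  by rewrite /= /small_entry (negbTE nab) ab.
move/(word_cong_rel (R := _))/pm_wordP.
by rewrite !pm_wordE !big_cons !big_nil !mulg1 !mulgA.
Qed.

(** The default 1 beyond the height allows products over natural numbers. *)
Let g s (k : nat) : G := if insub k is Some y then gen (s, y) else 1.

Let gE s (y : 'I_height) : g s y = gen (s, y).
Proof. by rewrite /g valK. Qed.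

Let g_commute s t i j :
  ~~ [&& s != t, (i.+1 == j) || (j.+1 == i) & i %/ block s t == j %/ block s t]%N ->
  commute (g s i) (g t j).
Proof.
rewrite /g; case: insubP => [y _ <-|_ _]; last exact/commute_sym/commute1.
case: insubP => [z _ <-|_ _]; last exact/commute1.
by move=> nadj; apply: gen_commute; rewrite /vadj.
Qed.

Let g_braid s t i : s != t -> (i.+1 < height)%N ->
  (i %/ block s t == i.+1 %/ block s t)%N ->
  g s i * g t i.+1 * g s i = g t i.+1 * g s i * g t i.+1.
Proof.
move=> st li e.
rewrite -[i.+1]/(nat_of_ord (Ordinal li)) -[i]/(nat_of_ord (Ordinal (ltnW li))).
by rewrite !gE; apply: gen_braid; rewrite /vadj /= st eqxx.
Qed.

Let column_word s :
  pm_word (artin_rel (small_matrix vadj_sym) id) (column s) =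
  \prod_(0 <= k < height) g s k.
Proof.
have -> : \prod_(0 <= k < height) g s k = \prod_(y <- enum 'I_height) gen (s, y).
  rewrite /index_iota subn0 -val_enum_ord big_map.
  by apply: eq_bigr => y _; rewrite gE.
by rewrite pm_wordE big_map.
Qed.

Section Pair.
Variables s t : S.
Hypothesis st : s != t.
Let n := block s t.
Let q := (height %/ n)%N.

Let n_gt0 : (0 < n)%N. Proof. exact: block_gt0. Qed.

Let heightE : height = (q * n)%N.
Proof. by rewrite /q divnK // block_dvd. Qed.

Let letter (b : bool) := if b then t else s.

(* The i-th generator of the component of type A in the b-th block whose even
   vertices lie over letter e. *)
Let comp (be : 'I_q * bool) (i : nat) : G :=
  g (letter (odd i (+) be.2)) (be.1 * n + i)%N.

Let layer be c := \prod_(0 <= i < n | odd i == c) comp be i.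

Let comp_block (b i : nat) : (i < n)%N -> ((b * n + i) %/ n = b)%N.
Proof. by move=> li; rewrite divnMDl // divn_small ?addn0. Qed.

Let letter_block (c d : bool) : letter c != letter d ->
  block (letter c) (letter d) = n.
Proof.
by rewrite /letter; case: c; case: d; rewrite ?eqxx // => _; rewrite block_sym.
Qed.

Let letter_neq (c d : bool) : c != d -> letter c != letter d.
Proof. by case: c; case: d => // _; rewrite // eq_sym. Qed.

Let comp_commute be be' i j : be != be' -> (i < n)%N -> (j < n)%N ->
  commute (comp be i) (comp be' j).
Proof.
case: be be' => [b e] [b' e'] nbe li lj; apply: g_commute.
apply: contraNN nbe => /and3P[nl ij]; rewrite letter_block //= !comp_block //.
move=> /eqP bb; rewrite -pair_eqE /= -val_eqE /= bb eqxx /=.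
move: ij nl; rewrite bb => ij.
have -> : odd j = ~~ odd i.
  by move: ij; rewrite -!addnS !eqn_add2l => /orP[]/eqP <-; rewrite /= ?negbK.
by move=> {ij}; case: (odd i) e e' => [] [] [] //=; rewrite eqxx.
Qed.

Let layers be : \prod_(a <- alt_word (layer be false) (layer be true) n.+1) a =
  \prod_(a <- alt_word (layer be true) (layer be false) n.+1) a.
Proof.
have mapE c d m : \prod_(a <- alt_word (layer be c) (layer be d) m) a =
    \prod_(b <- alt_word c d m) layer be b.
  by rewrite !prod_alt_word.
rewrite !mapE; apply: alternating_typeA.
- move=> i j li lj ij; apply: g_commute; apply/negP => /and3P[_ e _]; lia.
- move=> i li; rewrite /comp addnS /=.
  have -> : letter (~~ odd i (+) be.2) = letter (~~ (odd i (+) be.2)).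
    by rewrite addNb.
  apply: g_braid.
  + by apply: letter_neq; case: (_ (+) _).
  + rewrite heightE; have := ltn_ord be.1; nia.
  + rewrite letter_block; last by apply: letter_neq; case: (_ (+) _).
    by rewrite -addnS !comp_block // ltnW.
Qed.

(** In each block the two columns form two zigzag paths, told apart by the letter over their even
    vertices. A column takes the vertices of one parity from one path and those of the other parity
    from the other. *)
Let column_layers c : \prod_(0 <= k < height) g (letter c) k =
  \prod_(b : 'I_q) (layer (b, false) c * layer (b, true) (~~ c)).
Proof.
rewrite heightE big_nat_mul big_mkord; apply: eq_bigr => b _.
rewrite -{1}[(b * n)%N]add0n big_addn mulSn addnK.
rewrite (@row_split _ (fun i => g (letter c) (i + b * n)%N) n xpredT
  (fun i => odd i == c) (fun i => odd i == ~~ c)).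
- congr (_ * _); apply: eq_bigr => i /eqP oi; rewrite /comp /= oi addnC.
    by rewrite addbF.
  by rewrite addbT negbK.
- by move=> i _; case: (odd i); case: (c).
- by move=> i _; case: (odd i); case: (c).
- by move=> i j _ _ _ _; apply: g_commute; rewrite eqxx.
Qed.

Let layer_commute be be' c d : be != be' -> commute (layer be c) (layer be' d).
Proof.
move=> nbe; rewrite /layer big_nat_cond [X in commute _ X]big_nat_cond.
apply: commute_prod => j /andP[/andP[_ lj] _]; apply/commute_sym.
apply: commute_prod => i /andP[/andP[_ li] _]; apply/commute_sym.
exact: comp_commute.
Qed.

Lemma column_alternating :
  let w u := pm_word (artin_rel (small_matrix vadj_sym) id) (column u) in
  \prod_(a <- alt_word (w s) (w t) n.+1) a =
  \prod_(a <- alt_word (w t) (w s) n.+1) a.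
Proof.
move=> w; rewrite /w !column_word (column_layers false) (column_layers true).
apply: (@alt_word_prod _ _ (fun b => layer (b, false) false * layer (b, true) true)
  (fun b => layer (b, false) true * layer (b, true) false)) => [b b' nb|b].
  have neq e e' : (b, e) != (b', e') by rewrite -pair_eqE /= negb_and nb.
  by split; apply: commuteM; apply/commute_sym; apply: commuteM;
    apply: layer_commute; rewrite eq_sym.
by rewrite !alt_word_mul ?layers //; apply: layer_commute; rewrite -pair_eqE /= andbF.
Qed.

End Pair.

Lemma fold_word_cong u v : word_cong (artin_rel M id) u v ->
  word_cong (artin_rel (small_matrix vadj_sym) id) (fold_word u) (fold_word v).
Proof.
have wordE w : pm_word (artin_rel (small_matrix vadj_sym) id) (fold_word w) =
    \prod_(a <- [seq pm_word (artin_rel (small_matrix vadj_sym) id) (column s) | s <- w]) a.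
  elim: w => [|s w IHw]; first by rewrite /= big_nil.
  by rewrite /fold_word /= pm_word_cat big_cons -IHw.
have mapE (A B : Type) (f : A -> B) a b m :
    [seq f x | x <- alt_word a b m] = alt_word (f a) (f b) m.
  by elim: m a b => //= m IHm a b; rewrite IHm.
elim=> {u v} [_ _ [s t m st Mst]|u|u v _ IH|u v w _ IHu _ IHv|u u' v v' _ IHu _ IHv].
- apply/pm_wordP; rewrite !wordE !mapE.
  have -> : m = (block s t).+1.
    rewrite /block /fin_entry Mst prednK //.
    by apply: leq_trans (coxeter_offdiag st Mst).
  exact: column_alternating.
- exact: word_cong_refl.
- exact: word_cong_sym.
- exact: word_cong_trans IHu IHv.
- by rewrite !fold_cat; apply: word_cong_cat.
Qed.

End Relation.

(** * Walks of interval roots in a component of type A *)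

Local Notation pr := (pr vadj).
Local Notation Phi := (Phi vadj).
Local Notation opw := (opw vadj).
Notation vec := {ffun vertex -> int}.

(* The end points of an interval starting as [i, i + 1): they travel outwards for e,
   resp. d, rounds, rest for one round, and then travel backwards. *)
Definition left_end e i k := if (k <= e)%N then (i - k)%N else (i + k - e.*2.+1)%N.
Definition right_end d i k := if (k <= d)%N then (i + k).+1 else (i + d.*2.+2 - k)%N.

(** Moving out adds the vertex p - 1, moving in removes [p]. These have opposite parities, and the
    active parity alternates from round to round; hence the rest of one round before turning
    back. *)
Lemma left_end_step e i k x : (e <= i)%N -> odd (x + i) = odd k.+1 ->
  let p := left_end e i k in let p' := left_end e i k.+1 in
  [\/ p = p'.+1 /\ odd x != odd p, p = p' /\ odd x != odd p
    | p' = p.+1 /\ odd x = odd p].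
Proof.
move=> ei par p p'; rewrite /p /p' /left_end; have [ke|ke] := ltnP k e.
  by constructor 1; rewrite (ltnW ke); lia.
move: ke; rewrite leq_eqVlt => /orP[/eqP ke|ke].
  by constructor 2; rewrite -ke leqnn; lia.
by constructor 3; rewrite (leqNgt k e) ke /=; lia.
Qed.

Lemma right_end_step d i k x : (k <= i + d)%N -> odd (x + i) = odd k.+1 ->
  let q := right_end d i k in let q' := right_end d i k.+1 in
  [\/ q' = q.+1 /\ odd x = odd q, q = q' /\ odd x = odd q
    | q = q'.+1 /\ odd x != odd q].
Proof.
move=> ki par q q'; rewrite /q /q' /right_end; have [kd|kd] := ltnP k d.
  by constructor 1; rewrite (ltnW kd); lia.
move: kd; rewrite leq_eqVlt => /orP[/eqP kd|kd].
  by constructor 2; rewrite -kd leqnn; lia.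
by constructor 3; rewrite (leqNgt k d) kd /=; lia.
Qed.

Lemma ends_lt e d i n k : (e <= i)%N -> (i + d < n)%N -> (k <= (e + d).+1)%N ->
  (left_end e i k < right_end d i k)%N /\ (right_end d i k <= n)%N.
Proof.
by rewrite /left_end /right_end => ei idn kj; do ![case: ifP => ?]; split; lia.
Qed.

(** For a vertex [x] of the active column, [d] is its pairing with the interval root, by [prI_kap];
    the two alternatives are those that [opw_commuting_ge] asks for. *)
Lemma interval_step (p q p' q' x : nat) :
  (p < q)%N -> (p' < q')%N ->
  [\/ p = p'.+1 /\ odd x != odd p, p = p' /\ odd x != odd p
    | p' = p.+1 /\ odd x = odd p] ->
  [\/ q' = q.+1 /\ odd x = odd q, q = q' /\ odd x = odd q
    | q = q'.+1 /\ odd x != odd q] ->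
  let d : int := (p <= x < q)%N%:Z * 2 - (p < x <= q)%N%:Z
    - (p <= x.+1 < q)%N%:Z in
  (p' <= x < q')%N%:Z = (p <= x < q)%N%:Z - d \/
  (p' <= x < q')%N%:Z = (p <= x < q)%N%:Z /\ d <= 0.
Proof.
move=> pq pq' hp hq.
have hp' : [\/ p' = p /\ (x != p)%N, p'.+1 = p /\ (x != p)%N | p' = p.+1 /\ x.+1 != p].
  by case: hp => -[? ?]; [constructor 2|constructor 1|constructor 3]; lia.
have hq' : [\/ q' = q /\ x.+1 != q, q' = q.+1 /\ x.+1 != q | q'.+1 = q /\ x != q].
  by case: hq => -[? ?]; [constructor 2|constructor 1|constructor 3]; lia.
(* The interval is never the single active vertex [x]: both ends would then move in and cross. *)
have nb : (x == p) && (x.+1 == q) = false.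
  by apply/negP => /andP[/eqP ? /eqP ?]; case: hp => -[? ?]; case: hq => -[? ?]; lia.
clear hp hq.
have [xp|xp|xp] := ltngtP x p; have [xq|xq|xq] := ltngtP x.+1 q.
all: by case: hp' => -[? ?]; case: hq' => -[? ?]; lia.
Qed.

Lemma left_end_last e d i : (e <= i)%N ->
  left_end e i (e + d).+1 = (i + d - e)%N.
Proof. by move=> ei; rewrite /left_end ltnNge leq_addr /=; lia. Qed.

Lemma right_end_last e d i : (e <= i)%N ->
  right_end d i (e + d).+1 = (i + d - e).+1.
Proof. by move=> ei; rewrite /right_end ltnNge leq_addl /=; lia. Qed.

Section Walk.
Variables s t : S.
Hypothesis st : s != t.
Variables (e d : nat) (y0 : 'I_height).
Let n := block s t.
Let b := (y0 %/ n)%N.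
Let i := (y0 %% n)%N.
Let j := (e + d).+1.
Hypotheses (le_ei : (e <= i)%N) (lt_idn : (i + d < n)%N).

Let n_gt0 : (0 < n)%N. Proof. exact: block_gt0. Qed.

Definition alt_letter k := if odd k then s else t.

(* The component of type A containing the vertex y0 over the letter alt_letter j. *)
Let kap x : vertex := (alt_letter (j + x + i), insubd y0 (b * n + x)%N).

Let kap2 x : (x < n)%N -> (kap x).2 = (b * n + x)%N :> nat.
Proof.
move=> lx; rewrite /= val_insubd; case: ifP => // /negbT/negP[].
have lb : (b < height %/ n)%N by rewrite ltn_divLR // divnK ?block_dvd ?ltn_ord.
rewrite -[X in (_ < X)%N](divnK (block_dvd st)).
apply: (@leq_trans (b.+1 * n)); last by rewrite leq_mul2r lb orbT.
by rewrite mulSn addnC ltn_add2r.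
Qed.

Let alt_letter_eq k k' : (alt_letter k == alt_letter k') = (odd k == odd k').
Proof.
by rewrite /alt_letter; case: (odd k); case: (odd k');
  rewrite ?eqxx ?(negbTE st) // eq_sym (negbTE st).
Qed.

Let alt_letter_block k k' : odd k != odd k' ->
  block (alt_letter k) (alt_letter k') = n.
Proof.
by rewrite /alt_letter; case: (odd k); case: (odd k') => // _; rewrite block_sym.
Qed.

Let kap_eq x x' : (x < n)%N -> (x' < n)%N -> (kap x == kap x') = (x == x').
Proof.
move=> lx lx'; apply/eqP/eqP => [e'|-> //].
have := f_equal (fun a : vertex => nat_of_ord a.2) e'.
by rewrite !kap2 // => /addnI.
Qed.

Let kap_adj x x' : (x < n)%N -> (x' < n)%N ->
  vadj (kap x) (kap x') = (x.+1 == x') || (x'.+1 == x).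
Proof.
move=> lx lx'; rewrite /vadj !kap2 // alt_letter_eq -!addnS !eqn_add2l.
case: (boolP (_ || _)) => [near|]; last by rewrite andbF.
have neq : odd (j + x + i) != odd (j + x' + i).
  by move: near => /orP[]/eqP <-; rewrite addnS addSn /=; case: (odd _).
by rewrite neq /= alt_letter_block // !divnMDl // !divn_small // eqxx.
Qed.

Let kap_cases z : z.1 = s \/ z.1 = t ->
  (exists2 x, (x < n)%N & z = kap x) \/
  (forall x, (x < n)%N -> z != kap x /\ ~~ vadj z (kap x)).
Proof.
move=> zst; have [/andP[/eqP zb /eqP zl]|nz] :=
    boolP ((z.2 %/ n == b)%N && (z.1 == alt_letter (j + z.2 %% n + i))).
  left; exists (z.2 %% n)%N; first by rewrite ltn_mod.
  case: z zst zb zl => [u y] /= _ zb zl; rewrite /kap -zl; congr (_, _).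
  apply/val_inj => /=; rewrite val_insubd -zb -divn_eq ltn_ord //.
right=> x lx; split.
  apply: contraNneq nz => ->; rewrite kap2 // divnMDl // modnMDl.
  by rewrite divn_small // modn_small // addn0 !eqxx.
apply: contraNN nz => /and3P[nl near]; rewrite kap2 //= in near nl *.
have zkE : block z.1 (alt_letter (j + x + i)) = n.
  move: nl; rewrite /alt_letter.
  by case: zst => ->; case: (odd _); rewrite ?eqxx // block_sym.
rewrite zkE divnMDl // (divn_small lx) addn0 => /eqP zb.
rewrite zb eqxx /=.
have par : odd (z.2 %% n) != odd x.
  move: near; rewrite {1 2}(divn_eq z.2 n) zb -!addnS !eqn_add2l.
  by case/orP => /eqP; [move=> <-|move=> {1}<-]; rewrite /=; case: (odd _).
move: nl par; rewrite /alt_letter !oddD.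
by case: zst => ->; case: (odd j); case: (odd (z.2 %% n)); case: (odd x);
  case: (odd i) => //=; rewrite ?eqxx // => _ _; rewrite eq_sym.
Qed.

Let I p q : vec := \sum_(p <= x < q) alpha (kap x).

Let prI z p q : pr z (I p q) = \sum_(p <= x < q) pr z (alpha (kap x)).
Proof. exact: (big_morph _ (prD vadj z) (pr0 vadj z)). Qed.

Let sum_delta p q (a : nat) :
  \sum_(p <= x < q) (x == a)%:Z = (p <= a < q)%N%:Z.
Proof.
elim: q => [|q IHq]; first by rewrite big_geq //; lia.
have [pq|qp] := leqP p q; last by rewrite big_geq //; lia.
by rewrite big_nat_recr //= IHq; lia.
Qed.

Let sum_deltaS p q (a : nat) :
  \sum_(p <= x < q) (x.+1 == a)%:Z = (p < a <= q)%N%:Z.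
Proof.
elim: q => [|q IHq]; first by rewrite big_geq //; lia.
have [pq|qp] := leqP p q; last by rewrite big_geq //; lia.
by rewrite big_nat_recr //= IHq; lia.
Qed.

Let I_kap p q x : (q <= n)%N -> (x < n)%N -> I p q (kap x) = (p <= x < q)%N%:Z.
Proof.
move=> qn lx; rewrite sum_ffunE -sum_delta; apply: eq_big_nat => x' /andP[_ lx'].
by rewrite ffunE kap_eq 1?eq_sym //; exact: leq_trans qn.
Qed.

Let prI_kap p q x : (q <= n)%N -> (x < n)%N ->
  pr (kap x) (I p q) = (p <= x < q)%N%:Z * 2 - (p < x <= q)%N%:Z
    - (p <= x.+1 < q)%N%:Z.
Proof.
move=> qn lx; rewrite prI -!sum_delta -sum_deltaS big_distrl -!sumrB /=.
apply: eq_big_nat => x' /andP[_ lx'q].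
have lx' : (x' < n)%N by apply: leq_trans qn.
have [->|nx] := eqVneq x' x; first by rewrite (pr_alpha_same vadj_irr); lia.
have nk : kap x != kap x' by rewrite kap_eq // eq_sym.
have [near|far] := boolP (vadj (kap x) (kap x')).
  by rewrite (pr_alpha_adj vadj_irr) //; move: near; rewrite kap_adj //; lia.
by rewrite pr_alpha_perp //; move: far; rewrite kap_adj //; lia.
Qed.

Let I_out p q z : (q <= n)%N -> (forall x, (x < n)%N -> z != kap x) ->
  I p q z = 0.
Proof.
move=> qn nz; rewrite sum_ffunE big_nat_cond big1 // => x /andP[/andP[_ lx] _].
by rewrite ffunE (negbTE (nz _ _)) //; exact: leq_trans qn.
Qed.

Let prI_out p q z : (q <= n)%N ->
  (forall x, (x < n)%N -> z != kap x /\ ~~ vadj z (kap x)) -> pr z (I p q) = 0.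
Proof.
move=> qn nz; rewrite prI big_nat_cond big1 // => x /andP[/andP[_ lx] _].
have [|neq nadj] := nz x; first exact: leq_trans qn.
exact: pr_alpha_perp.
Qed.

Let Phi_I p q : (p < q)%N -> (q <= n)%N -> Phi (I p q).
Proof.
elim: q => // q IHq; rewrite ltnS leq_eqVlt => /orP[/eqP -> _|pq qn].
  by rewrite /I big_nat1; exact: Phi_alpha.
have qn' : (q <= n)%N := ltnW qn.
have prq := prI_kap p qn' qn; have Iq := I_kap p qn' qn.
have -> : I p q.+1 = refl vadj (kap q) (I p q).
  apply/ffunP => z; rewrite [in RHS]ffunE /I big_nat_recr ?(ltnW pq) //= -/(I p q).
  rewrite ffunE [alpha _ _]ffunE prq.
  case: (z =P kap q) => [->|_]; last by rewrite addr0.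
  by rewrite Iq; lia.
apply: Phi_up; first exact: IHq.
by rewrite prq; lia.
Qed.

Let P := left_end e i.
Let Q := right_end d i.

(** At a root the operator of the last letter is evaluated first, so the walk reads the word
    backwards; [j + k.+1] has the parity of the index [j - k.+1] and avoids truncated
    subtraction. *)
Let round k (f : vec -> int) : (k < j)%N -> (forall v, Phi v -> 0 <= f v) ->
  f (I (P k.+1) (Q k.+1)) <= opw 0 (column (alt_letter (j + k.+1))) f (I (P k) (Q k)).
Proof.
move=> lkj f0.
have [PQ Qkn] := ends_lt le_ei lt_idn (ltnW lkj).
have [PQ' Qkn'] := ends_lt le_ei lt_idn lkj.
have par x : (alt_letter (j + x + i) == alt_letter (j + k.+1)) =
    (odd (x + i) == odd k.+1).
  by rewrite alt_letter_eq -addnA ![odd (j + _)]oddD (inj_eq (@addbI _)).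
have Pstep x := @left_end_step e i k x le_ei.
have lk : (k <= i + d)%N by apply: (@leq_trans (e + d)); rewrite ?leq_add2r.
have Qstep x := @right_end_step d i k x lk.
have inl z : z \in column (alt_letter (j + k.+1)) -> z.1 = s \/ z.1 = t.
  by rewrite mem_column /alt_letter => /eqP ->; case: ifP; [left|right].
apply: (opw_commuting_ge vadj_sym vadj_irr (column_uniq _) (@column_perp _) f0).
- exact: Phi_I.
- move=> z zl Iz; have := f_equal (pr z) Iz; rewrite (pr_alpha_same vadj_irr).
  case: (kap_cases (inl z zl)) => [[x lx ez]|out]; last by rewrite prI_out.
  move: zl; rewrite mem_column ez par prI_kap // => /eqP par'.
  have := Pstep x par'; have := Qstep x par'; move: PQ PQ'.
  rewrite -/(P k) -/(P k.+1) -/(Q k) -/(Q k.+1) /=.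
  move: (P k) (P k.+1) (Q k) (Q k.+1) => p p' q q' pq pq' hq hp; clear -pq pq' hq hp.
  by case: hp => -[? ?]; case: hq => -[? ?]; lia.
- move=> z zl.
  have [zst|] := boolP ((z.1 == s) || (z.1 == t)); last first.
    move=> nzst; rewrite !I_out // => x _; apply: contraNneq nzst => ->;
    by rewrite /= /alt_letter; case: ifP; rewrite eqxx ?orbT.
  have zst' : z.1 = s \/ z.1 = t by case/orP: zst => /eqP; [left|right].
  case: (kap_cases zst') => [[x lx ez]|out]; last first.
    by rewrite !I_out // => x /out[].
  move: zl; rewrite mem_column ez par !I_kap // => par'.
  have par'' : odd (x.+1 + i) = odd k.+1 by move: par'; rewrite addSn /=; lia.
  have := Pstep _ par''; have := Qstep _ par''; move: PQ PQ'.
  rewrite -/(P k) -/(P k.+1) -/(Q k) -/(Q k.+1) /=.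
  move: (P k) (P k.+1) (Q k) (Q k.+1) => p p' q q' pq pq' hq hp; clear -pq pq' hq hp.
  by case: hp => -[? ?]; case: hq => -[? ?]; lia.
- move=> z zl.
  case: (kap_cases (inl z zl)) => [[x lx ez]|out]; last first.
    by left; rewrite prI_out // !I_out ?subr0 // => x /out[].
  move: zl; rewrite mem_column ez par prI_kap // !I_kap // => /eqP par'.
  exact: (interval_step PQ PQ' (Pstep x par') (Qstep x par')).
Qed.

Let nth_alt x0 (u u' : S) m k : (k < m)%N ->
  nth x0 (alt_word u u' m) k = if odd k then u' else u.
Proof.
elim: m k u u' => // m IHm [|k] u u' //=.
by rewrite ltnS => /IHm ->; case: (odd k).
Qed.

Let size_alt (u u' : S) m : size (alt_word u u' m) = m.
Proof. by elim: m u u' => //= m IHm u u'; rewrite IHm. Qed.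

Let rounds k (f : vec -> int) : (k <= j)%N -> (forall v, Phi v -> 0 <= f v) ->
  opw 0 (fold_word (take (j - k) (alt_word t s j))) f (I (P k) (Q k)) <=
  opw 0 (fold_word (alt_word t s j)) f (I (P 0) (Q 0)).
Proof.
move=> + f0; elim: k => [|k IHk] lk.
  by rewrite subn0 -{1}(size_alt t s j) take_size.
apply: le_trans (IHk (ltnW lk)).
have -> : (j - k = (j - k.+1).+1)%N by rewrite subnSK.
rewrite (take_nth t) ?size_alt; last by lia.
rewrite nth_alt -/(alt_letter _); last by lia.
rewrite -cats1 fold_cat opw_cat /fold_word /= cats0.
have -> : alt_letter (j - k.+1) = alt_letter (j + k.+1).
  by apply/eqP; rewrite alt_letter_eq oddB // oddD.
apply: round => // v Pv; exact: (opw_ge0 vadj_sym vadj_irr).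
Qed.

(** The interval starts as the single vertex [y0] over the letter that would continue the
    alternating word. After [j] rounds it has shrunk to the vertex at position i + d - e, which by
    parity lies over [s]. *)
Lemma walk_ge1 : exists y,
  1 <= opw 0 (fold_word (alt_word t s j)) (delta (s, y))
         (alpha (alt_letter j, y0)).
Proof.
exists (kap (P j)).2.
have PE : P j = (i + d - e)%N := left_end_last d le_ei.
have QE : Q j = (P j).+1 by rewrite PE; exact: right_end_last.
have f0 v : Phi v -> 0 <= delta (s, (kap (P j)).2) v by rewrite /delta; lia.
have := rounds (leqnn j) f0; rewrite subnn take0 /= /I QE big_nat1.
have -> : Q 0 = (P 0).+1 by rewrite /P /Q /left_end /right_end /= addn0 subn0.
rewrite big_nat1.
have -> : kap (P j) = (s, (kap (P j)).2).
  congr (_, _); rewrite /alt_letter PE /j ifT //.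
  have -> : ((e + d).+1 + (i + d - e) + i = (d + i).*2.+1)%N.
    by move: le_ei; move: (i) => i0 ei; lia.
  by rewrite /= odd_double.
have -> : kap (P 0) = (alt_letter j, y0).
  rewrite /P /left_end /= subn0; congr (_, _).
    by apply/eqP; rewrite alt_letter_eq -addnA addnn oddD odd_double addbF.
  by apply/val_inj; rewrite val_insubd -divn_eq ltn_ord.
by rewrite /delta eqxx.
Qed.

End Walk.

(** * Reading off the left divisors *)

Definition left_div (u : seq S) s := exists w, word_cong (artin_rel M id) u (s :: w).

Lemma word_cong_size u v : word_cong (artin_rel M id) u v -> size u = size v.
Proof.
have size_alt (a b : S) m : size (alt_word a b m) = m.
  by elim: m a b => //= m IHm a b; rewrite IHm.
elim=> {u v} [_ _ [s t m _ _]|//|//|u v w _ -> _ -> //|u u' v v' _ IHu _ IHv].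
  by rewrite !size_alt.
by rewrite !size_cat IHu IHv.
Qed.

Lemma opw_fold_cong (R : comNzRingType) (x : R) u v (f : vec -> R) :
  word_cong (artin_rel M id) u v ->
  eq_on_Phi vadj (opw x (fold_word u) f) (opw x (fold_word v) f).
Proof.
move=> uv; apply: (opw_cong (adj_sym := vadj_sym) vadj_irr vadj_tri).
exact: fold_word_cong.
Qed.

Lemma left_div_vanish u s y : left_div u s ->
  eq_on_Phi vadj (opw 0 (fold_word u) (delta (s, y))) (fun _ => 0).
Proof.
case=> w usw v Pv; rewrite (opw_fold_cong _ _ usw Pv) /= opw_cat.
rewrite -[RHS](opw_zero vadj (fold_word w) v).
apply: (eq_opw vadj_sym vadj_irr) Pv.
apply: (opw_delta_commuting vadj_sym vadj_irr _ (@column_perp s)).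
by rewrite mem_column.
Qed.

(** Split off the longest alternating prefix in [t] and [s], up to congruence. It is shorter than
    the label, since otherwise a braid relation would bring [s] to the front, and by maximality the
    next letter of the alternation does not divide the rest. The induction gives the rest a positive
    value for that letter, and the walk carries it back to [s]. *)
Lemma nleft_div_nvanish u s : (size u <= ell)%N -> ~ left_div u s ->
  exists y v, Phi v /\ 0 < opw 0 (fold_word u) (delta (s, y)) v.
Proof.
have [k le_k] := ubnP (size u); elim: k => // k IHk in u s le_k *.
case: u le_k => [|t u1] le_k uell nsu.
  exists (Ordinal height_gt0), (alpha (s, Ordinal height_gt0)).
  by split; [exact: Phi_alpha|rewrite /= /delta eqxx].
have st : s != t.
  by apply/eqP => e; apply: nsu; exists u1; rewrite e; exact: word_cong_refl.
set u := t :: u1 in le_k uell nsu *.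
have size_alt (a b : S) m : size (alt_word a b m) = m.
  by elim: m a b => //= m IHm a b; rewrite IHm.
pose prefix j := `[< exists w, word_cong (artin_rel M id) u (alt_word t s j ++ w) >].
have prefix1 : prefix 1 by apply/asboolP; exists u1; exact: word_cong_refl.
have prefix_le j : prefix j -> (j <= size u)%N.
  by case/asboolP => w /word_cong_size ->; rewrite size_cat size_alt leq_addr.
have ex_prefix : exists j, prefix j by exists 1.
case: (ex_maxnP ex_prefix prefix_le) => j /asboolP[w uw] max_j.
have j_gt0 : (0 < j)%N by apply: max_j.
have alt_rcons m (a b : S) :
    alt_word a b m.+1 = rcons (alt_word a b m) (if odd m then b else a).
  elim: m a b => // m IHm a b; rewrite -[LHS]/(a :: alt_word b a m.+1) IHm /=.
  by case: (odd m).
have nwl : ~ left_div w (alt_letter s t j).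
  case=> w' ww'; have := max_j j.+1; rewrite ltnn => /(_ _)/negP/(_ _) [] //.
  apply/asboolP; exists w'; apply: word_cong_trans uw _.
  rewrite alt_rcons cat_rcons; apply: word_cong_cat ww'; exact: word_cong_refl.
have size_w : size u = (j + size w)%N.
  by rewrite (word_cong_size uw) size_cat size_alt.
have lt_jm : (j <= block s t)%N.
  rewrite /block /fin_entry; case E: (M s t) => [m|]; last first.
    (* For an infinite label the length of the word bounds the prefix; this fixes the size of the
       substitute for +oo. *)
    apply: leq_trans (leqW uell); apply: prefix_le.
    by apply/asboolP; exists w.
  rewrite leqNgt; apply/negP => lt_mj; apply: nsu.
  have m_gt1 := coxeter_offdiag st E.
  have take_alt a b q p : (p <= q)%N ->
      take p (alt_word a b q) = alt_word a b p :> seq S.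
    by elim: q p a b => [|q IHq] [|p] a b //= pq; rewrite IHq.
  exists (behead (alt_word s t m) ++ (drop m (alt_word t s j) ++ w)).
  have altE : alt_word t s j = alt_word t s m ++ drop m (alt_word t s j).
    rewrite -(take_alt t s j m) ?cat_take_drop //.
    by rewrite -(prednK (ltnW m_gt1)).
  apply: word_cong_trans uw _; rewrite {1}altE -catA -cat_cons.
  have -> : s :: behead (alt_word s t m) = alt_word s t m by case: m m_gt1 {E lt_mj altE}.
  apply: word_cong_cat; last exact: word_cong_refl.
  apply: word_cong_rel.
  by apply: (ArtinRel id) => //; [rewrite eq_sym|rewrite coxeter_sym].
have [y0 [v [Pv pos]]] : exists y v,
    Phi v /\ 0 < opw 0 (fold_word w) (delta (alt_letter s t j, y)) v.
  apply: IHk => //; lia.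
pose i := (y0 %% block s t)%N.
have n_gt0 := block_gt0 st.
have i_lt : (i < block s t)%N by rewrite ltn_mod.
(* The interval must stay within the path 0, ..., n - 1: the left end goes out as far as [i] and [j]
   permit, and [j <= n] leaves room for the right end to make up the remaining rounds. *)
pose e := minn i j.-1; pose d := (j.-1 - e)%N.
have jE : j = (e + d).+1 by rewrite /d /e; lia.
have [||y ge1] := @walk_ge1 s t st e d y0.
- by rewrite -/i /e geq_minl.
- by rewrite -/i /d /e; lia.
exists y, v; split; first exact: Pv.
rewrite (opw_fold_cong _ _ uw Pv) fold_cat opw_cat; apply: lt_le_trans pos _.
apply: (opw_mono vadj_sym vadj_irr) => // z Pz.
rewrite {1}/delta; case: eqP => [->|_]; last first.
  by apply: (opw_ge0 vadj_sym vadj_irr) => // z' _; rewrite /delta; lia.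
by rewrite jE.
Qed.

(** * The action of the Artin group *)

Section GroupAction.
Variables (K : fieldType) (x : K).
Hypotheses (x0 : x != 0) (two0 : 2%:R != 0 :> K).

Definition letter_op (f : vec -> K) (l : S * bool) : vec -> K :=
  if l.2 then opw_inv vadj x (column l.1) f else opw x (column l.1) f.

Definition group_op u f := foldl letter_op f u.

Lemma eq_group_op u f g : eq_on_Phi vadj f g ->
  eq_on_Phi vadj (group_op u f) (group_op u g).
Proof.
elim: u f g => //= l u IHu f g fg; apply: IHu; rewrite /letter_op.
case: l.2; first exact: (eq_opw_inv vadj_sym vadj_irr).
exact: (eq_opw vadj_sym vadj_irr).
Qed.

Lemma group_op_pos u f : group_op [seq (s, false) | s <- u] f = opw x (fold_word u) f.
Proof.
elim: u f => //= s u IHu f; rewrite IHu /letter_op /=.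
by rewrite -opw_cat.
Qed.

Lemma group_op_cong u v f :
  word_cong (group_rel (artin_rel M (fun s : S => (s, false)))) u v ->
  eq_on_Phi vadj (group_op u f) (group_op v f).
Proof.
have map_alt (s t : S) m : alt_word (s, false) (t, false) m =
    [seq (s, false) | s <- alt_word s t m].
  by elim: m s t => //= m IHm s t; rewrite IHm.
move=> uv; elim: uv f => {u v} [u v|//|||].
- case=> {u v} [_ _ [s t m st Mst]|s [] ] f.
  + rewrite !map_alt !group_op_pos; apply: opw_fold_cong.
    exact/word_cong_rel/(ArtinRel id st Mst).
  + exact: (opw_invK vadj_sym vadj_irr x0 two0).
  + exact: (opwK vadj_sym vadj_irr x0 two0).
- by move=> u v _ IH f z Pz; rewrite IH.
- by move=> u v w _ IHu _ IHv f z Pz; rewrite IHu ?IHv.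
- move=> u u' v v' _ IHu _ IHv f z Pz.
  rewrite /group_op !foldl_cat -!/(group_op _ _) IHv //.
  exact: (eq_group_op v' (IHu f)).
Qed.

End GroupAction.

(** * Recovering a word from its action *)

Section Faithful.
Let K := {fraction {poly int}}.
Let x : K := tofrac 'X.

Let x_neq0 : x != 0. Proof. by rewrite tofrac_eq0 polyX_eq0. Qed.

Let two_neq0 : 2%:R != 0 :> K.
Proof.
have -> : 2%:R = tofrac 2%:R :> K by rewrite rmorph_nat.
by rewrite tofrac_eq0 -polyC_natr polyC_eq0.
Qed.

(* Specializing the indeterminate of K at 0 recovers the positive operators. *)
Let specialize u v (f : vec -> int) :
  (forall g : vec -> K, eq_on_Phi vadj (opw x u g) (opw x v g)) ->
  eq_on_Phi vadj (opw 0 u f) (opw 0 v f).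
Proof.
move=> uv z Pz; pose fp w : {poly int} := (f w)%:P.
have e : opw 'X u fp z = opw 'X v fp z.
  by apply/eqP; rewrite -tofrac_eq !(opw_rmorph vadj (@tofrac {poly int})) uv.
pose h : {rmorphism {poly int} -> int} := horner_eval (0 : int).
have hX : h 'X = 0 by rewrite /= /horner_eval hornerX.
have evalE w : opw 0 w f z = h (opw 'X w fp z).
  rewrite (opw_rmorph vadj h) hX; apply: (eq_opw vadj_sym vadj_irr) Pz => y _.
  by rewrite /= /horner_eval hornerC.
by rewrite !evalE e.
Qed.

Lemma fold_faithful u v : (size u <= ell)%N -> (size v <= ell)%N ->
  (forall f : vec -> K,
     eq_on_Phi vadj (opw x (fold_word u) f) (opw x (fold_word v) f)) ->
  word_cong (artin_rel M id) u v.
Proof.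
elim: u v => [|s u IHu] v ul vl uv.
  case: v vl uv => [|s v] _ uv; first exact: word_cong_refl.
  have y := Ordinal height_gt0.
  have sv : left_div (s :: v) s by exists v; exact: word_cong_refl.
  have Pz := Phi_alpha vadj (s, y).
  have := left_div_vanish y sv Pz; rewrite -(specialize (delta (s, y)) uv Pz).
  by rewrite /= /delta eqxx.
have su : left_div (s :: u) s by exists u; exact: word_cong_refl.
have [v' vv'] : left_div v s.
  apply: contrapT => nv; have [y [z [Pz pos]]] := nleft_div_nvanish vl nv.
  move: pos; rewrite -(specialize (delta (s, y)) uv Pz).
  by rewrite (left_div_vanish y su Pz) ltxx.
have v'l : (size v' <= ell)%N.
  by apply: leq_trans vl; rewrite (word_cong_size vv') ltnW.
apply: word_cong_trans (word_cong_sym vv').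
apply: (@word_cong_cat _ _ [:: s] [:: s]); first exact: word_cong_refl.
apply: IHu => //; first exact: ltnW.
move=> f z Pz.
(* This cancels the common first letter: on roots, [f] is the image of [g] under the column of
   [s]. *)
pose g := opw_inv vadj x (column s) f.
have gf : eq_on_Phi vadj (opw x (column s) g) f.
  exact: (opw_invK vadj_sym vadj_irr x_neq0 two_neq0).
have gE w : opw x (fold_word (s :: w)) g z = opw x (fold_word w) f z.
  by rewrite /= opw_cat; apply: (eq_opw vadj_sym vadj_irr x _ gf).
by rewrite -!gE uv // (opw_fold_cong _ _ vv').
Qed.

Lemma iota_faithful u v : (size u <= ell)%N -> (size v <= ell)%N ->
  word_cong (group_rel (artin_rel M (fun s : S => (s, false))))
    [seq (s, false) | s <- u] [seq (s, false) | s <- v] ->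
  word_cong (artin_rel M id) u v.
Proof.
move=> ul vl uv; apply: fold_faithful => // f z Pz.
rewrite -!group_op_pos.
exact: (group_op_cong x_neq0 two_neq0 f uv).
Qed.

End Faithful.
End Folding.

Theorem theorem1p1 (S : finType) (M : coxeter_matrix S) :
  injective (@artin_iota S M).
Proof.
have iotaE u : @artin_iota S M (pm_word (artin_rel M id) u) =
    pm_word (group_rel (artin_rel M (fun s : S => (s, false))))
      [seq (s, false) | s <- u].
  by rewrite /artin_iota pm_lift_word pm_wordE big_map.
move=> a b; rewrite -(pm_reprK a) -(pm_reprK b) !iotaE => /pm_wordP e.
apply/pm_wordP.
(* The folding is chosen for the two words at hand, with the larger of their lengths as [ell]. *)
by apply: (@iota_faithful _ _ (maxn (size (pm_repr a)) (size (pm_repr b))) _ _ _ _ e);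
  rewrite leq_max leqnn ?orbT.
Qed.
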